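(* Let $n\ge 2$. An element $w\in\tilde D_{n+2}$ is CFC if and only if one (equivalently, any) of its reduced expressions $\mathbf{w}$ satisfies one of the following conditions: (a) each generator occurs at most once in $\mathbf{w}$; (b) $\mathbf{w}$ is an alternating word, $|\mathbf{w}_{s_1}|=\cdots=|\mathbf{w}_{s_{n-1}}|\ge 2$, and $|\mathbf{w}_{t_1}|=|\mathbf{w}_{t_2}|=|\mathbf{w}_{u_1}|=|\mathbf{w}_{u_2}|=|\mathbf{w}_{s_1}|/2$ (in particular, $|\mathbf{w}_{s_1}|$ is even); (c) $\mathbf{w}$ is a subword of the infinite periodic word $(t_1t_2s_1s_2\cdots s_{n-1}u_1u_2s_{n-1}\cdots s_2s_1)^{\infty}$, where $t_1$ and $t_2$, $u_1$ and $u_2$ are allowed to commute, such that $|\mathbf{w}_{s_1}|=\cdots=|\mathbf{w}_{s_{n-1}}|\ge 2$ and $|\mathbf{w}_{t_1}|=|\mathbf{w}_{t_2}|=|\mathbf{w}_{u_1}|=|\mathbf{w}_{u_2}|=|\mathbf{w}_{s_1}|/2$.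
   Context: $\tilde D_{n+2}$ is the affine Coxeter group with generators $t_1,t_2,s_1,\dots,s_{n-1},u_1,u_2$ whose Coxeter diagram has edges $t_1-s_1$, $t_2-s_1$, $s_i-s_{i+1}$ ($1\le i\le n-2$), $s_{n-1}-u_1$, $s_{n-1}-u_2$, all with $m=3$ (all other pairs commute). An element of a Coxeter group is fully commutative (FC) if any two of its reduced expressions are related by a sequence of transpositions of adjacent commuting generators. A cyclic shift of a word $s_{i_1}\cdots s_{i_k}$ is any word $s_{i_j}\cdots s_{i_k}s_{i_1}\cdots s_{i_{j-1}}$. An element is cyclically fully commutative (CFC) if every cyclic shift of every one of its reduced expressions is a reduced expression of an FC element. $|\mathbf{w}_s|$ is the number of occurrences of $s$ in $\mathbf{w}$. ''$\mathbf{w}$ is an alternating word'' means: after replacing $t_1,t_2$ by $s_0$, and $u_1,u_2$ by $s_n$, for each $i=0,\dots,n-1$ the occurrences of $s_i$ alternate with those of $s_{i+1}$ (in the sequence obtained by keeping only the letters $s_i,s_{i+1}$, no two consecutive letters are equal), and moreover in $\mathbf{w}$ the occurrences of $t_1$ and $t_2$ alternate and the occurrences of $u_1$ and $u_2$ alternate. ''Subword'' of an infinite word means a finite factor of consecutive letters; ''allowed to commute'' means that each factor $t_1t_2$ (resp. $u_1u_2$) of the periodic word may independently be replaced by $t_2t_1$ (resp. $u_2u_1$). *)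

(* Defs.v *)
From HB Require Import structures.
From Stdlib Require Import Relation_Operators.
From mathcomp Require Import all_boot.
From mathcomp Require Import boolp.

Set Implicit Arguments.
Unset Strict Implicit.
Unset Printing Implicit Defensive.

Local Open Scope group_scope.
Local Open Scope quotient_scope.

(* The value [cm s t = 0] stands for m(s,t) = oo (no relation). *)
Record coxeter_matrix (I : eqType) := CoxeterMatrix {
  cm :> I -> I -> nat;
  cm_diag : forall s, cm s s = 1%N;
  cm_off : forall s t, s != t -> cm s t != 1%N;
  cm_sym : forall s t, cm s t = cm t s
}.

Section CoxeterGroup.
Variables (I : choiceType) (m : coxeter_matrix I).

(* The congruence on words generated by (s t)^m(s,t) = 1; since m(s,s) = 1, it
   contains s s = 1, so the quotient monoid is the group with presentation m. *)
Inductive cox_eq : seq I -> seq I -> Prop :=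
| cox_eq_refl u : cox_eq u u
| cox_eq_sym u v : cox_eq u v -> cox_eq v u
| cox_eq_trans u v w : cox_eq u v -> cox_eq v w -> cox_eq u w
| cox_eq_rel u v s t :
    cox_eq (u ++ flatten (nseq (m s t) [:: s; t]) ++ v) (u ++ v).

Lemma cox_eq_cat u u' v v' :
  cox_eq u u' -> cox_eq v v' -> cox_eq (u ++ v) (u' ++ v').
Proof.
move=> uu' vv'; apply: (@cox_eq_trans _ (u' ++ v)).
  elim: uu' => {u u'} [u|u u' _|u1 u2 u3 _ IH1 _|u u' s t].
  - exact: cox_eq_refl.
  - exact: cox_eq_sym.
  - exact: cox_eq_trans.
  - by rewrite -!catA; apply: cox_eq_rel.
elim: vv' => {v v'} [v|v v' _|v1 v2 v3 _ IH1 _|v v' s t].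
- exact: cox_eq_refl.
- exact: cox_eq_sym.
- exact: cox_eq_trans.
- by rewrite !(catA u'); apply: cox_eq_rel.
Qed.

Lemma cox_eq_revl u : cox_eq (rev u ++ u) [::].
Proof.
elim: u => [|s u IH]; first exact: cox_eq_refl.
rewrite rev_cons -cats1 -catA /=; apply: cox_eq_trans IH.
by have := cox_eq_rel (rev u) u s s; rewrite cm_diag.
Qed.

Lemma cox_eq_rev u v : cox_eq u v -> cox_eq (rev u) (rev v).
Proof.
move=> uv; apply: (@cox_eq_trans _ (rev u ++ v ++ rev v)).
  rewrite -{1}[rev u]cats0; apply: cox_eq_cat; first exact: cox_eq_refl.
  by apply: cox_eq_sym; have := cox_eq_revl (rev v); rewrite revK.
rewrite catA -{2}[rev v]cat0s; apply: cox_eq_cat; last exact: cox_eq_refl.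
apply: cox_eq_trans (cox_eq_revl u).
by apply: cox_eq_cat; [apply: cox_eq_refl | apply: cox_eq_sym].
Qed.

Definition cox_eqb : rel (seq I) := fun u v => `[< cox_eq u v >].

Lemma cox_eqb_equiv : equiv_class_of cox_eqb.
Proof.
split=> [u|u v|v u w /asboolP uv /asboolP vw].
- by apply/asboolP; apply: cox_eq_refl.
- by apply/idP/idP => /asboolP uv; apply/asboolP/cox_eq_sym.
- by apply/asboolP; apply: cox_eq_trans uv vw.
Qed.

Canonical cox_equiv := EquivRelPack cox_eqb_equiv.

Definition coxeter_group := {eq_quot cox_equiv}.

HB.instance Definition _ := Choice.on coxeter_group.

Implicit Types x y z : coxeter_group.

Definition cox_class (u : seq I) : coxeter_group := \pi_{eq_quot cox_equiv} u.

Lemma cox_classP u v : cox_class u = cox_class v <-> cox_eq u v.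
Proof. by split=> [/eqquotP/asboolP | uv] //; apply/eqquotP/asboolP. Qed.

Lemma cox_class_repr x : cox_class (repr x) = x.
Proof. exact: reprK. Qed.

Lemma repr_cox_class u : cox_eq (repr (cox_class u)) u.
Proof. by apply/cox_classP; rewrite cox_class_repr. Qed.

Definition cox_one : coxeter_group := cox_class [::].
Definition cox_mul x y : coxeter_group := cox_class (repr x ++ repr y).
Definition cox_inv x : coxeter_group := cox_class (rev (repr x)).

Lemma cox_class_cat u v : cox_mul (cox_class u) (cox_class v) = cox_class (u ++ v).
Proof. by apply/cox_classP; apply: cox_eq_cat; apply: repr_cox_class. Qed.

Lemma cox_class_rev u : cox_inv (cox_class u) = cox_class (rev u).
Proof. by apply/cox_classP; apply: cox_eq_rev; apply: repr_cox_class. Qed.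

Lemma cox_mulA : associative cox_mul.
Proof.
move=> x y z; rewrite -(cox_class_repr x) -(cox_class_repr y).
by rewrite -(cox_class_repr z) !cox_class_cat catA.
Qed.

Lemma cox_mul1 : left_id cox_one cox_mul.
Proof. by move=> x; rewrite -(cox_class_repr x) cox_class_cat. Qed.

Lemma cox_mulx1 : right_id cox_one cox_mul.
Proof. by move=> x; rewrite -(cox_class_repr x) cox_class_cat cats0. Qed.

Lemma cox_mulV : left_inverse cox_one cox_inv cox_mul.
Proof.
move=> x; rewrite -(cox_class_repr x) cox_class_rev cox_class_cat.
by apply/cox_classP; apply: cox_eq_revl.
Qed.

Lemma cox_mulxV : right_inverse cox_one cox_inv cox_mul.
Proof.
move=> x; rewrite -(cox_class_repr x) cox_class_rev cox_class_cat.
by apply/cox_classP; have := cox_eq_revl (rev (repr x)); rewrite revK.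
Qed.

HB.instance Definition _ := isGroup.Build coxeter_group
  cox_mulA cox_mul1 cox_mulx1 cox_mulV cox_mulxV.

Definition cox_gen (s : I) : coxeter_group := cox_class [:: s].

Definition cox_prod (u : seq I) : coxeter_group := \prod_(s <- u) cox_gen s.

Lemma cox_prodE u : cox_prod u = cox_class u.
Proof.
rewrite /cox_prod; elim: u => [|s u IH]; first by rewrite big_nil.
by rewrite big_cons IH; apply: cox_class_cat.
Qed.

Definition reduced_expr (u : seq I) (x : coxeter_group) : Prop :=
  cox_prod u = x /\ forall v, cox_prod v = x -> (size u <= size v)%N.

Inductive comm_step : seq I -> seq I -> Prop :=
  CommStep u v s t of m s t = 2 :
    comm_step (u ++ [:: s; t] ++ v) (u ++ [:: t; s] ++ v).

Definition fully_commutative (x : coxeter_group) : Prop :=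
  forall u v, reduced_expr u x -> reduced_expr v x ->
    clos_refl_trans _ comm_step u v.

Definition cyclically_fully_commutative (x : coxeter_group) : Prop :=
  forall u k, reduced_expr u x ->
    exists y, reduced_expr (rot k u) y /\ fully_commutative y.

End CoxeterGroup.

Local Close Scope group_scope.

(* [Sg i] is the generator s_(i+1), so that s_1, ..., s_(n-1) are
   Sg 0, ..., Sg (n-2). *)
Inductive dgen (n : nat) := T1 | T2 | Sg of 'I_n.-1 | U1 | U2.
Arguments T1 {n}.
Arguments T2 {n}.
Arguments Sg {n} _.
Arguments U1 {n}.
Arguments U2 {n}.

Section AffineD.
Variable n : nat.
Implicit Types (g h : dgen n) (w : seq (dgen n)).

Definition dgen_code g : (bool + bool) + 'I_n.-1 :=
  match g with
  | T1 => inl (inl true) | T2 => inl (inl false)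
  | Sg i => inr i
  | U1 => inl (inr true) | U2 => inl (inr false)
  end.

Definition dgen_decode (c : (bool + bool) + 'I_n.-1) : dgen n :=
  match c with
  | inl (inl b) => if b then T1 else T2
  | inr i => Sg i
  | inl (inr b) => if b then U1 else U2
  end.

Lemma dgen_codeK : cancel dgen_code dgen_decode.
Proof. by case. Qed.

HB.instance Definition _ := Finite.copy (dgen n) (can_type dgen_codeK).

(* Each edge of the diagram, in one of its two orientations. *)
Definition dedge g h : bool :=
  match g, h with
  | T1, Sg i | T2, Sg i => i == 0 :> nat
  | Sg i, Sg j => j == i.+1 :> nat
  | Sg i, U1 | Sg i, U2 => i.+1 == n.-1
  | _, _ => false
  end.

Definition dmat g h : nat :=
  if g == h then 1 else if dedge g h || dedge h g then 3 else 2.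

Lemma dmat_diag g : dmat g g = 1.
Proof. by rewrite /dmat eqxx. Qed.

Lemma dmat_off g h : g != h -> dmat g h != 1.
Proof. by rewrite /dmat => /negPf->; case: ifP. Qed.

Lemma dmat_sym g h : dmat g h = dmat h g.
Proof. by rewrite /dmat eq_sym orbC. Qed.

Definition affineD_matrix : coxeter_matrix (dgen n) :=
  CoxeterMatrix dmat_diag dmat_off dmat_sym.

(* The group \tilde D_(n+2). *)
Definition affineD := coxeter_group affineD_matrix.

Definition occ g w : nat := count_mem g w.

(* The occurrences of a alternate with those of b in w. *)
Definition alternate (T : eqType) (a b : T) (w : seq T) : bool :=
  sorted [rel x y | x != y] [seq x <- w | (x == a) || (x == b)].

(* The replacement of t_1, t_2 by s_0 and of u_1, u_2 by s_n; s_i is coded by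
   the number i. *)
Definition collapse g : nat :=
  match g with T1 | T2 => 0 | Sg i => i.+1 | U1 | U2 => n end.

Definition alternating w : Prop :=
  [/\ forall i, i < n -> alternate i i.+1 (map collapse w),
      alternate T1 T2 w & alternate U1 U2 w].

(* One period t1 t2 s_1 ... s_(n-1) u1 u2 s_(n-1) ... s_1; t1 t2 is replaced by
   t2 t1 if a holds, and u1 u2 by u2 u1 if b holds. *)
Definition period (a b : bool) : seq (dgen n) :=
  (if a then [:: T2; T1] else [:: T1; T2])
  ++ [seq Sg i | i <- enum 'I_n.-1]
  ++ (if b then [:: U2; U1] else [:: U1; U2])
  ++ rev [seq Sg i | i <- enum 'I_n.-1].

Definition period_len : nat := size (period false false).

(* The infinite word whose q-th period is [period (a q) (b q)]. *)
Definition periodic_word (a b : nat -> bool) (k : nat) : dgen n :=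
  nth T1 (period (a (k %/ period_len)) (b (k %/ period_len)))
    (k %% period_len).

(* w is a finite factor of the infinite word p. *)
Definition factor_of (T : Type) (w : seq T) (p : nat -> T) : Prop :=
  exists k, w = mkseq (fun j => p (k + j)) (size w).

(* |w_g| = |w_(s_1)| / 2 is an exact equality, forcing |w_(s_1)| to be even. *)
Definition balanced w : Prop :=
  [/\ forall i j : 'I_n.-1, occ (Sg i) w = occ (Sg j) w,
      forall i : 'I_n.-1, 2 <= occ (Sg i) w &
      forall i : 'I_n.-1, i = 0 :> nat ->
        [/\ (occ T1 w).*2 = occ (Sg i) w, (occ T2 w).*2 = occ (Sg i) w,
            (occ U1 w).*2 = occ (Sg i) w & (occ U2 w).*2 = occ (Sg i) w]].

Definition cfc_form w : Prop :=
  [\/ forall g, occ g w <= 1,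
      alternating w /\ balanced w |
      (exists a b, factor_of w (periodic_word a b)) /\ balanced w].

End AffineD.

(* Main.v *)
From Stdlib Require Import Relation_Operators.
Require Import Defs.
From mathcomp Require Import all_boot ssralg ssrint boolp zify.

Set Implicit Arguments.
Unset Strict Implicit.
Unset Printing Implicit Defensive.

(** In a simply laced Coxeter group a word is a reduced expression of a fully
    commutative element exactly when, between any two consecutive occurrences of
    a letter [s], at least two letters fail to commute with [s]
    ([fc_word_gapP], [fc_word_unique], [reduced_fc_word]).  This follows from the
    exchange condition, which is obtained from the reflections attached to the
    letters of a word: the parity of the number of occurrences of a reflection
    depends only on the element.  Hence an element is cyclically fully
    commutative if and only if the gap condition holds for every rotation of one,
    equivalently any, of its reduced expressions ([cfc_cyc_fc], [cyc_fc_cfc]),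
    and the classification becomes a question about periodic words.

    Let such a cyclic word use some letter twice, and let N(g) be the number of
    occurrences of [g].  Adding up the gaps of [g] shows that 2 N(g) is at most
    the sum of N over the neighbours of [g] whenever N(g) is at least 2.  On the
    affine diagram D this convexity leaves only the multiples of the null vector
    (1, 1, 2, ..., 2, 1, 1) of the Cartan matrix ([convex_balanced]), and then
    every gap contains exactly two neighbours ([nb_const]).  So the number of
    neighbours of [g] met since the last [g], the charge of [g], stays in
    {0, 1, 2}, and reading the word is a chip-firing process: a letter is read at
    charge 2, its charge drops to 0, and each of its neighbours gains 1.

    The parity of the sum of the charges of t_1 and t_2 never changes
    ([end_parity]).  If it is odd, exactly one of t_1, t_2 is read between
    consecutive s_1, and this alternation propagates along the diagram to the
    other end ([toggles_next], [odd_other_end]), which is form (b).  If it is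
    even, at some moment both t_1 and t_2 have charge 2; the gaps of the letters
    around that moment are nested in one another ([nested_next]), which determines
    all the charges ([even_down0]), and from there the process has no choice but
    to read the periodic word ([firing_periodic]), which is form (c).

    Conversely, an alternating word satisfies the gap condition
    ([alternating_fc]) and balance keeps its rotations alternating; a factor of
    the periodic word is a firing sequence, and balance makes it return to its
    initial charges, so that its rotations are firing sequences as well
    ([firing_cyc_fc]). *)

(** * Reflections of a word and the exchange condition *)

Section Reflections.
Variables (I : choiceType) (m : coxeter_matrix I).
Local Open Scope group_scope.
Local Notation W := (coxeter_group m).
Local Notation g := (@cox_gen I m).
Local Notation cl := (@cox_class I m).
Implicit Types (u v w : seq I) (s t : I) (x y r : W).

Lemma cox_class_cons s u : cl (s :: u) = g s * cl u.
Proof. by rewrite -[s :: u]cat1s -cox_class_cat. Qed.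

Lemma cox_classM u v : cl (u ++ v) = cl u * cl v.
Proof. by rewrite -cox_class_cat. Qed.

Lemma cox_class_nil : cl [::] = 1.
Proof. by []. Qed.

Lemma cox_genK s : g s * g s = 1.
Proof.
rewrite /cox_gen -cox_classM -cox_class_nil; apply/cox_classP.
by have := cox_eq_rel m [::] [::] s s; rewrite cm_diag.
Qed.

Lemma cox_genV s : (g s)^-1 = g s.
Proof. by apply/mulg1_eq/cox_genK. Qed.

Lemma cox_genX s t : (g s * g t) ^+ m s t = 1.
Proof.
have -> k : (g s * g t) ^+ k = cl (flatten (nseq k [:: s; t])).
  elim: k => [|k IH] //=; rewrite expgS IH !cox_class_cons mulgA //.
rewrite -cox_class_nil; apply/cox_classP.
by have := cox_eq_rel m [::] [::] s t; rewrite cats0.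
Qed.

Definition aconj x y : W := x * y * x^-1.

Lemma aconj1 y : aconj 1 y = y.
Proof. by rewrite /aconj mul1g invg1 mulg1. Qed.

Lemma aconjM x x' y : aconj (x * x') y = aconj x (aconj x' y).
Proof. by rewrite /aconj invgM !mulgA. Qed.

Lemma aconj_inj x : injective (aconj x).
Proof. by move=> y z /mulIg/mulgI. Qed.

(** The entry at a letter [s] of [u = u1 ++ s :: u2] is [s] conjugated by [u1]:
    multiplying the element on the left by it erases that letter. *)
Fixpoint reflections u : seq W :=
  if u is s :: u' then g s :: map (aconj (g s)) (reflections u') else [::].

Lemma size_reflections u : size (reflections u) = size u.
Proof. by elim: u => //= s u <-; rewrite size_map. Qed.

Lemma reflections_cat u v :
  reflections (u ++ v) = reflections u ++ map (aconj (cl u)) (reflections v).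
Proof.
elim: u => [|s u IH] /=.
  by rewrite (eq_map aconj1) map_id.
rewrite IH map_cat -map_comp; congr (_ :: _ ++ _).
by apply: eq_map => y; rewrite cox_class_cons /= aconjM.
Qed.

(** The entries run through powers of the rotation [g s * g t], so the list of a
    relator repeats itself with period [m s t]. *)
Lemma reflections_alternating s t k :
  reflections (flatten (nseq k [:: s; t])) =
  mkseq (fun i => (g s * g t) ^+ i * g s) k.*2.
Proof.
elim: k => [|k IH] //=.
rewrite IH {IH} /mkseq.
have -> : iota 0 k.+1.*2 = 0 :: 1%N :: map (addn 2) (iota 0 k.*2).
  by rewrite -iotaDl.
rewrite map_cons map_cons expg0 mul1g expg1 -!map_comp.
congr [:: _, _ & _]; first by rewrite /aconj cox_genV.
apply: eq_map => i; rewrite /comp -aconjM /aconj add2n !expgS invgM !cox_genV.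
rewrite -!mulgA; do 2 congr (_ * _).
by rewrite !(mulgA (g s) (g t)) [LHS]mulgA [RHS]mulgA -expgSr -expgS.
Qed.

(** Inserting a relator adds its list of reflections, conjugated; every entry of
    that list appears twice, which leaves parities unchanged.  The reflections of
    odd multiplicity are the inversions of the element. *)
Lemma odd_count_reflections u v x :
  cl u = cl v ->
  odd (count_mem x (reflections u)) = odd (count_mem x (reflections v)).
Proof.
move=> /cox_classP; elim => {u v} [//|u v _ ->|u v w _ -> _ ->|u v s t] //.
set d := flatten _.
have dE : cl d = 1.
  by rewrite -cox_class_nil; apply/cox_classP; have := cox_eq_rel m [::] [::] s t; rewrite cats0.
rewrite !reflections_cat !count_cat map_cat count_cat dE (eq_map aconj1) map_id.
rewrite !oddD; congr (_ (+) _); rewrite -[RHS]addFb; congr (_ (+) _).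
rewrite count_map /d reflections_alternating /mkseq -addnn iotaD map_cat count_cat.
have -> : iota (0 + m s t) (m s t) = map (addn (m s t)) (iota 0 (m s t)).
  by rewrite -iotaDl addnC.
rewrite -map_comp.
rewrite [X in _ + count _ X](_ : _ = [seq (g s * g t) ^+ i * g s | i <- iota 0 (m s t)]).
  by rewrite addnn odd_double.
by apply: eq_map => i /=; rewrite expgnDr cox_genX mul1g.
Qed.

(** The exchange condition: the element of [reflections u] equal to [r] points to
    the letter that [r] erases. *)
Lemma reflection_deletion u r : r \in reflections u ->
  exists u1 s u2, u = u1 ++ s :: u2 /\ r * cl u = cl (u1 ++ u2).
Proof.
elim: u r => [|s u IH] r //=; rewrite inE => /orP[/eqP->|/mapP[r' /IH]].
  by exists [::], s, u; rewrite cox_class_cons mulgA cox_genK mul1g.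
move=> [u1 [t [u2 [-> E]]]] ->; exists (s :: u1), t, u2; split=> //=.
by rewrite !cox_class_cons /aconj cox_genV -E -!mulgA (mulgA (g s) (g s)) cox_genK mul1g.
Qed.

(** A reflection that occurs once has odd multiplicity, so it cannot be absent
    from another word of the same element. *)
Lemma reflections_sub u v : uniq (reflections u) -> cl u = cl v ->
  {subset reflections u <= reflections v}.
Proof.
move=> Uu E x xu; rewrite -has_pred1 has_count.
have := odd_count_reflections x E; rewrite count_uniq_mem // xu.
by case: (count _ (reflections v)).
Qed.

Lemma uniq_reflections_size u v : uniq (reflections u) -> cl u = cl v ->
  size u <= size v.
Proof.
move=> Uu E; rewrite -[size u]size_reflections -[size v]size_reflections.
exact/uniq_leq_size/reflections_sub.
Qed.

Lemma eq_reflections u v : uniq (reflections u) -> cl u = cl v ->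
  size u = size v -> reflections u =i reflections v.
Proof.
move=> Uu E S; apply: (uniq_min_size Uu (reflections_sub Uu E) _).2.
by rewrite !size_reflections S.
Qed.

End Reflections.

(** * The local criterion for full commutativity *)

Lemma map_filter_split (T U : Type) (f : T -> U) (P : pred T) w A c B :
  [seq f h | h <- w & P h] = A ++ c :: B ->
  exists w1 h w2, [/\ w = w1 ++ h :: w2, P h, f h = c,
    [seq f h | h <- w1 & P h] = A & [seq f h | h <- w2 & P h] = B].
Proof.
elim: w A => [|h w IH] A /=; first by case: A.
case Ph: (P h) => /=; last first.
  by move=> /IH[w1 [h' [w2 [-> ? ? <- ?]]]]; exists (h :: w1), h', w2; split=> //=; rewrite Ph.
case: A => [[<- <-]|a A [<- /IH[w1 [h' [w2 [-> ? ? <- ?]]]]]].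
  by exists [::], h, w.
by exists (h :: w1), h', w2; split=> //=; rewrite Ph.
Qed.

Section LocalCriterion.
Variables (I : choiceType) (m : coxeter_matrix I).
Implicit Types (u v w : seq I) (s t h : I).

Definition bonded s h := (h != s) && (m s h != 2).

(** The projection to the letters that do not commute with [s], remembering only
    which of them are [s].  Exchanging two commuting letters does not alter it: if
    both survive the projection, both are different from [s]. *)
Definition trace s w := [seq h == s | h <- w & (h == s) || bonded s h].

(** The two patterns are those of the factors [s s] and [s t s]; no longer braid
    exists in the simply laced case. *)
Definition fc_word w := forall s,
  ~~ infix [:: true; true] (trace s w) /\
  ~~ infix [:: true; false; true] (trace s w).

Local Notation comm_equiv := (clos_refl_trans (seq I) (comm_step m)).

Lemma trace_cat s u v : trace s (u ++ v) = trace s u ++ trace s v.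
Proof. by rewrite /trace filter_cat map_cat. Qed.

Lemma trace_cons s h w :
  trace s (h :: w) = if h == s then true :: trace s w
                     else if bonded s h then false :: trace s w else trace s w.
Proof.
rewrite /trace /=; case: eqP => //= [->|]; first by rewrite eqxx.
by case: ifP => //= _ /eqP/negPf->.
Qed.

Lemma comm2_neq s t : m s t = 2 -> s != t.
Proof. by apply: contra_eqN => /eqP->; rewrite cm_diag. Qed.

Lemma trace_comm s u v : comm_step m u v -> trace s u = trace s v.
Proof.
case=> {u v} u v a b mab; rewrite !trace_cat; congr (_ ++ _); congr (_ ++ _).
rewrite !trace_cons; have ab := comm2_neq mab.
case: eqP => [as_|]; case: eqP => [bs|] //; subst.
- by rewrite /bonded mab eqxx andbF.
- by rewrite /bonded (cm_sym m) mab eqxx andbF.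
- by do 2 case: ifP.
Qed.

Lemma fc_word_comm u v : comm_equiv u v -> fc_word u -> fc_word v.
Proof.
elim=> {u v} [u v uv F s|//|u v w _ IH1 _ IH2 /IH1/IH2//].
by rewrite -(trace_comm s uv).
Qed.

Lemma comm_step_sym u v : comm_step m u v -> comm_step m v u.
Proof. by case=> {u v} u v s t mst; apply: CommStep; rewrite cm_sym. Qed.

Lemma comm_equiv_sym u v : comm_equiv u v -> comm_equiv v u.
Proof.
elim=> {u v} [u v /comm_step_sym uv|u|u v w _ uv _ vw].
- exact: rt_step.
- exact: rt_refl.
- exact: rt_trans vw uv.
Qed.

Lemma comm_equiv_cons s u v : comm_equiv u v -> comm_equiv (s :: u) (s :: v).
Proof.
elim=> {u v} [_ _ [u v a b mab]|u|u v w _ uv _ vw].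
- by apply: rt_step; rewrite -!(cat_cons s); apply: CommStep.
- exact: rt_refl.
- exact: rt_trans uv vw.
Qed.

Lemma comm_equiv_catl w u v : comm_equiv u v -> comm_equiv (w ++ u) (w ++ v).
Proof. by move=> uv; elim: w => //= s w; apply: comm_equiv_cons. Qed.

Lemma comm_equiv_swap s t u : m s t = 2 -> comm_equiv [:: s, t & u] [:: t, s & u].
Proof. by move=> mst; apply: rt_step; apply: (@CommStep _ _ [::] u s t). Qed.

Lemma comm_equiv_perm u v : comm_equiv u v -> perm_eq u v.
Proof.
elim=> {u v} [_ _ [u v a b _]|u|u v w _ uv _ vw].
- by rewrite perm_cat2l perm_cat2r; apply/permP => P /=; rewrite addnCA.
- exact: perm_refl.
- exact: perm_trans uv vw.
Qed.

Lemma comm_equiv_class u v : comm_equiv u v -> cox_class m u = cox_class m v.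
Proof.
elim=> {u v} [_ _ [u v a b mab]|u|u v w _ -> _ ->] //.
rewrite !cox_classM !cox_class_cons; congr (_ * (_ * _))%g.
have := cox_genX m a b.
by rewrite mab expgS expg1 => /mulg1_eq; rewrite invgM !cox_genV cox_class_nil !mulg1.
Qed.

Lemma fc_word_infix x u y : fc_word (x ++ u ++ y) -> fc_word u.
Proof.
move=> F s; have [F1 F2] := F s; rewrite !trace_cat in F1 F2; split.
  by apply: contraNN F1 => /infixP[a [b ->]]; apply/infixP;
    exists (trace s x ++ a), (b ++ trace s y); rewrite -!catA.
by apply: contraNN F2 => /infixP[a [b ->]]; apply/infixP;
  exists (trace s x ++ a), (b ++ trace s y); rewrite -!catA.
Qed.

Lemma trace_gap s y : s \notin y -> trace s y = nseq (count (bonded s) y) false.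
Proof.
elim: y => // h y IH; rewrite inE negb_or eq_sym => /andP[/negPf hs /IH].
by rewrite trace_cons hs /= => ->; case: ifP.
Qed.

(** The forbidden patterns are the gaps with no, respectively one, letter that
    does not commute with [s]. *)
Lemma fc_word_gapP w : fc_word w <-> forall x s y z,
  w = x ++ s :: y ++ s :: z -> s \notin y -> 1 < count (bonded s) y.
Proof.
split=> [F x s y z wE sy|F s].
  have [] := F s; rewrite wE trace_cat trace_cons eqxx trace_cat (trace_gap sy) trace_cons eqxx.
  case: (count _ _) => [|[|//]] F1 F2.
    by case/negP: F1; apply/infixP; exists (trace s x), (trace s z).
  by case/negP: F2; apply/infixP; exists (trace s x), (trace s z).
have no b : size b < 2 -> all negb b -> ~~ infix (true :: b ++ [:: true]) (trace s w).
  move=> b2 bF; apply/negP => /infixP[A [B]]; rewrite /= -catA /=.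
  move=> E; have [w1 [h [w2 [wE _ /eqP hs _ {}E]]]] := map_filter_split E.
  have [w3 [h' [w4 [w2E _ /eqP hs' Eb _]]]] := map_filter_split E; subst h h'.
  have sw3 : s \notin w3.
    apply: contraTN bF => sw3; rewrite -Eb all_map; apply/allPn; exists s => /=; rewrite ?eqxx //.
    by rewrite mem_filter eqxx.
  have := F w1 s w3 w4; rewrite wE w2E => /(_ erefl sw3).
  have := trace_gap sw3; rewrite /trace Eb => /(congr1 size); rewrite size_nseq => <-.
  by rewrite ltnNge -ltnS b2.
by split; [apply: (no [::])|apply: (no [:: false])].
Qed.

End LocalCriterion.

(** * Fully commutative elements of simply laced Coxeter groups *)

Section SimplyLaced.
Variables (I : choiceType) (m : coxeter_matrix I).
Hypothesis m23 : forall s t, s != t -> m s t = 2 \/ m s t = 3.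
Implicit Types (u v w : seq I) (s t h : I) (x : coxeter_group m).
Local Notation comm_equiv := (clos_refl_trans (seq I) (comm_step m)).
Local Notation g := (@cox_gen I m).
Local Notation cl := (@cox_class I m).

(** A move of Mozes's numbers game, that is, the action of [s] in the dual of the
    geometric representation. *)
Definition game_move s (c : I -> int) : I -> int := fun t =>
  (if t == s then - c s else if m s t == 3%N then c t + c s else c t)%R.

Lemma game_relator s t c :
  foldr game_move c (flatten (nseq (m s t) [:: s; t])) = c.
Proof.
have [->|st] := eqVneq s t.
  rewrite cm_diag /=; apply/funext => i; rewrite /game_move eqxx.
  by case: eqP => [->|_]; [lia|case: (m t i == 3) => /=; lia].
have ts : (t == s) = false by rewrite eq_sym (negPf st).
case: (m23 st) => mst; rewrite mst /=; apply/funext => i; rewrite /game_move !eqxx.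
all: rewrite ?(cm_sym m t s) ?mst ?ts ?(negPf st) /=.
all: have [->|is_] := eqVneq i s; rewrite ?(cm_sym m t s) ?mst ?ts ?(negPf st) /=; try lia.
all: have [->|it] := eqVneq i t; rewrite ?(cm_sym m t s) ?mst ?ts ?(negPf st) /=; try lia.
all: by case: (m s i == 3); case: (m t i == 3) => /=; lia.
Qed.

(** In the position with all numbers 1, the move at [s] produces its only negative
    number at [s]. *)
Lemma cox_gen_inj : injective g.
Proof.
move=> s t /cox_classP E; apply/eqP; rewrite -[_ == _]negbK; apply/negP => st.
have inv u v c : cox_eq m u v -> foldr game_move c u = foldr game_move c v.
  elim=> {u v} [//|u v _ ->//|u v w _ -> _ ->//|u v a b].
  by rewrite !foldr_cat game_relator.
have := congr1 (fun f => f s) (inv _ _ (fun=> 1%R) E).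
by rewrite /= /game_move eqxx (negPf st); case: ifP => _; lia.
Qed.

(** Tits's solution of the word problem, restricted to words to which no braid
    relation applies.  Both parts are proved by one induction on the length.
    If [s :: u] repeats a reflection, then [s] can be brought to the front of [u]
    by exchange, hence by commutations, and the pattern of [s s] appears.  If
    another word for the same element starts with [t], exchange brings [t] to the
    front of [s :: u] as well.  When [s] and [t] commute, the common second step
    closes the square; when they do not, a second exchange produces a word
    starting with [s t s], which the induction hypothesis makes
    commutation-equivalent to [s :: u], contrary to the criterion. *)
Lemma fc_word_unique u : fc_word m u ->
  uniq (reflections m u) /\
  forall v, cl v = cl u -> size v = size u -> comm_equiv u v.
Proof.
have [k] := ubnP (size u); elim: k => // k IH in u *; rewrite ltnS => uk Fu.
have IH1 w : size w < k -> fc_word m w -> uniq (reflections m w).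
  by move=> wk Fw; case: (IH w wk Fw).
have IH2 w v : size w < k -> fc_word m w -> cl v = cl w -> size v = size w ->
    comm_equiv w v.
  by move=> wk Fw; case: (IH w wk Fw) => _; apply.
case: u uk Fu => [|s u] /= uk Fu.
  by split=> // v _ /size0nil ->; apply: rt_refl.
have Fu' : fc_word m u.
  by apply: (@fc_word_infix _ _ [:: s] u [::]); rewrite cats0.
(* A reflection of [u] equal to [s] would bring [s] to the front of [u]. *)
have U : uniq (reflections m (s :: u)).
  rewrite /= (map_inj_uniq (aconj_inj (x := _))) IH1 // andbT.
  apply/negP => /mapP[r ru].
  move=> /(congr1 (aconj (g s))); rewrite -aconjM cox_genK aconj1 /aconj mulgK => rE.
  have [u1 [h [u2 [uE E]]]] := reflection_deletion ru.
  have suv : comm_equiv (s :: u) [:: s, s & u1 ++ u2].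
    apply/comm_equiv_cons/IH2 => //; last by rewrite uE !size_cat /= size_cat addnS.
    by rewrite cox_class_cons -E -rE mulgA cox_genK mul1g.
  have [] := fc_word_comm suv Fu s.
  by rewrite !trace_cons eqxx => /negP[]; apply/infixP; exists [::], (trace m s (u1 ++ u2)).
split=> // v vu sz; case: v sz vu => [|t v] // [sz] vu.
have [st|st] := eqVneq s t.
  subst t; apply/comm_equiv_cons/IH2 => //.
  by apply: (@mulgI _ (g s)); rewrite -!cox_class_cons.
have gst : g t <> g s by move=> /cox_gen_inj ts; rewrite ts eqxx in st.
have tu : g t \in map (aconj (g s)) (reflections m u).
  have := eq_reflections U (esym vu) (congr1 S (esym sz)) (g t).
  by rewrite /= !inE eqxx /= => /idP/orP[/eqP|].
have [u2 [sz2 E2]] : exists u2, size u = (size u2).+1 /\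
    cl (s :: u) = cl [:: t, s & u2].
  case/mapP: tu => r ru tE.
  have [u1 [h [u2 [uE E]]]] := reflection_deletion ru.
  exists (u1 ++ u2); split; first by rewrite uE !size_cat /= addnS.
  apply: (@mulgI _ (g t)); rewrite 3!cox_class_cons -E [RHS]mulgA cox_genK.
  rewrite mul1g {}tE /aconj cox_genV.
  by rewrite -!mulgA (mulgA (g s) (g s)) cox_genK mul1g.
have [mst|mst] := m23 st.
  (* Both words continue to the common word [s t u2 = t s u2]. *)
  have uu2 : comm_equiv u (t :: u2).
    apply: IH2 => //; apply: (@mulgI _ (g s)).
    rewrite -!cox_class_cons E2; apply: comm_equiv_class.
    exact: comm_equiv_swap.
  have su : comm_equiv (s :: u) [:: t, s & u2].
    by apply: rt_trans (comm_equiv_cons s uu2) (comm_equiv_swap u2 mst).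
  apply: (rt_trans _ _ _ _ _ su); apply: comm_equiv_cons; apply: IH2.
  - by rewrite /= -sz2.
  - apply: (@fc_word_infix _ _ [:: t] _ [::]); rewrite cats0.
    exact: fc_word_comm su Fu.
  - by apply: (@mulgI _ (g t)); rewrite -!cox_class_cons vu E2.
  - by rewrite /= -sz2.
have braid : (g s * g t * g s = g t * g s * g t)%g.
  have := cox_genX m s t; rewrite mst !expgS expg0 mulg1 !mulgA => E.
  by apply/divg1_eq; rewrite !invgM !cox_genV !mulgA.
have sE2 : g s \in reflections m [:: t, s & u2].
  by rewrite -(eq_reflections U E2) ?inE ?eqxx //= sz2.
(* As [s] is also an inversion of [t s u2], it erases a letter of [u2]. *)
have [u3 [sz3 E3]] : exists u3, size u2 = (size u3).+1 /\
    cl u = cl [:: t, s & u3].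
  move: sE2; rewrite /= !inE => /orP[/eqP/esym//|/orP[|]].
    rewrite /aconj cox_genV -braid => /eqP E.
    case: gst; apply: (@mulgI _ (g s)); rewrite cox_genK.
    by apply: (@mulIg _ (g s)); rewrite mul1g -E.
  case/mapP => r0 /mapP[r ru ->] sE.
  have [u1 [h [u3 [uE E]]]] := reflection_deletion ru.
  exists (u1 ++ u3); split; first by rewrite uE !size_cat /= addnS.
  apply: (@mulgI _ (g s)); rewrite -cox_class_cons E2.
  apply: (@mulgI _ (g s)); rewrite [RHS]mulgA cox_genK mul1g.
  rewrite {1}sE !cox_class_cons -E /aconj !cox_genV -!mulgA.
  by rewrite (mulgA (g t) (g t)) cox_genK mul1g (mulgA (g s) (g s)) cox_genK mul1g.
have uu3 : comm_equiv (s :: u) [:: s, t, s & u3].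
  by apply/comm_equiv_cons/IH2; rewrite //= sz2 sz3.
have ts : (t == s) = false by rewrite eq_sym (negPf st).
have [_] := fc_word_comm uu3 Fu s; rewrite !trace_cons eqxx /bonded ts mst.
by case/negP; apply/infixP; exists [::], (trace m s u3).
Qed.

Lemma fc_word_reduced u : fc_word m u -> reduced_expr u (cl u).
Proof.
move=> /fc_word_unique[U _]; split=> [|v]; rewrite cox_prodE // => /esym.
exact: uniq_reflections_size.
Qed.

Lemma fc_word_equiv u v : fc_word m u -> reduced_expr v (cl u) -> comm_equiv u v.
Proof.
move=> Fu [vE vmin]; have [_ umin] := fc_word_reduced Fu.
apply: (fc_word_unique Fu).2; first by rewrite -cox_prodE.
by apply/eqP; rewrite eqn_leq umin // vmin // cox_prodE.
Qed.

Lemma fc_word_fc u : fc_word m u -> fully_commutative (cl u).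
Proof.
move=> Fu v v' /(fc_word_equiv Fu) uv /(fc_word_equiv Fu) uv'.
exact: rt_trans (comm_equiv_sym uv) uv'.
Qed.

Lemma comm_equiv_pass s y z : s \notin y -> ~~ has (bonded m s) y ->
  comm_equiv (s :: y ++ z) (y ++ s :: z).
Proof.
elim: y => [|h y IH]; first by move=> _ _; apply: rt_refl.
rewrite inE !negb_or => /andP[sh sy] /= /andP[nb hy].
apply: (rt_trans _ _ _ [:: h, s & y ++ z]); last exact/comm_equiv_cons/IH.
apply: comm_equiv_swap; move: nb; rewrite /bonded negb_and !negbK.
by rewrite eq_sym (negPf sh) => /eqP.
Qed.

(** If a gap of [s] holds at most one letter that does not commute with [s], then
    commutations make its two ends meet, or meet that letter.  In the first case
    the word is not reduced; in the second a braid move changes the number of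
    occurrences of [s] and so leaves the commutation class. *)
Lemma reduced_fc_word u x : reduced_expr u x -> fully_commutative x ->
  fc_word m u.
Proof.
move=> ux fcx; have [uE umin] := ux; apply/fc_word_gapP => a s y z wE sy.
rewrite ltnNge; apply/negP; rewrite leq_eqVlt ltnS leqn0 => /orP[/eqP c1|c0].
  have hy : has (bonded m s) y by rewrite has_count c1.
  have [h [y1 [y2 [yE bh h1 h2]]]] : exists h y1 y2, [/\ y = y1 ++ h :: y2,
      bonded m s h, ~~ has (bonded m s) y1 & ~~ has (bonded m s) y2].
    case/split_find: hy c1 => h y1 y2 bh h1; rewrite cat_rcons count_cat /= bh.
    rewrite [count _ y1](_ : _ = 0); last by apply/eqP; rewrite -leqn0 leqNgt -has_count.
    rewrite add0n => -[c2]; exists h, y1, y2; split=> //.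
    by rewrite has_count -[count _ _]add0n c2.
  have sy1 : s \notin y1 by apply: contra sy; rewrite yE mem_cat => ->.
  have sy2 : s \notin y2 by apply: contra sy; rewrite yE mem_cat inE orbC => ->; rewrite ?orbT.
  have e1 : comm_equiv u (a ++ y1 ++ [:: s; h; s] ++ y2 ++ z).
    rewrite wE yE -!catA /=; apply: comm_equiv_catl.
    apply: rt_trans (comm_equiv_pass _ sy1 h1) _.
    apply/comm_equiv_catl/comm_equiv_cons/comm_equiv_cons/comm_equiv_sym.
    exact: comm_equiv_pass.
  have [sh|sh] := eqVneq s h; first by rewrite /bonded sh eqxx in bh.
  have msh : m s h = 3 by case: (m23 sh) bh => // E; rewrite /bonded E andbF.
  have e2 : cl [:: s; h; s] = cl [:: h; s; h].
    rewrite !cox_class_cons; have := cox_genX m s h.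
    rewrite msh !expgS expg0 !mulg1 -!mulgA => E.
    by apply/divg1_eq; rewrite !invgM !cox_genV -!mulgA.
  have e3 : cl (a ++ y1 ++ [:: h; s; h] ++ y2 ++ z) = x.
    rewrite -uE cox_prodE (comm_equiv_class e1) !(cox_classM m a).
    by rewrite !(cox_classM m y1) !(cox_classM m _ (y2 ++ z)) e2.
  have ux' : reduced_expr (a ++ y1 ++ [:: h; s; h] ++ y2 ++ z) x.
    split=> [|v vx]; first by rewrite cox_prodE.
    rewrite (leq_trans _ (umin v vx)) // (perm_size (comm_equiv_perm e1)).
    by rewrite !size_cat.
  have := comm_equiv_perm e1; rewrite (permPl (comm_equiv_perm (fcx _ _ ux ux'))).
  rewrite !perm_cat2l perm_cat2r => /permP/(_ (pred1 s)) /=.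
  by rewrite eqxx eq_sym (negPf sh).
have h0 : ~~ has (bonded m s) y by rewrite has_count lt0n c0.
have e1 : comm_equiv u (a ++ y ++ [:: s; s] ++ z).
  by rewrite wE; apply/comm_equiv_catl/comm_equiv_pass.
suff : size u <= size (a ++ y ++ z).
  by rewrite wE !size_cat /= size_cat /=; lia.
apply: umin.
  rewrite -uE !cox_prodE (comm_equiv_class e1) !cox_classM !cox_class_cons.
  by rewrite cox_class_nil mulg1 cox_genK mul1g.
Qed.

(** The form in which cyclic full commutativity is used: for a reduced
    expression [u] it says that the element of [u] is cyclically fully
    commutative. *)
Definition cyc_fc u := forall k, fc_word m (rot k u).

Lemma cfc_cyc_fc u x : cyclically_fully_commutative x -> reduced_expr u x ->
  cyc_fc u.
Proof. by move=> cx ux k; have [y [uy fy]] := cx u k ux; apply: reduced_fc_word uy fy. Qed.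

Lemma cyc_fc_rot k u : cyc_fc u -> cyc_fc (rot k u).
Proof. by move=> F j; rewrite rot_rot_add; apply: F. Qed.

(** All rotations but one of the new word are commutations of rotations of the
    old one.  The exception starts with [s] and ends with [t]; as [s] differs from
    [t], each of its gaps misses the first or the last letter, and so it is a gap
    of a commutation of a rotation of the old word. *)
Lemma cyc_fc_swap s t u : m s t = 2 -> cyc_fc [:: s, t & u] -> cyc_fc [:: t, s & u].
Proof.
move=> mst F [|[|k]]; rewrite /rot /=.
- by rewrite cats0; apply: fc_word_comm (comm_equiv_swap u mst) _; have := F 0; rewrite rot0.
- have F1 : fc_word m (s :: u).
    apply: (@fc_word_infix _ _ [:: t] _ [::]); rewrite cats0.
    by apply: fc_word_comm (comm_equiv_swap u mst) _; have := F 0; rewrite rot0.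
  have F2 : fc_word m (u ++ [:: t]).
    apply: (@fc_word_infix _ _ [::] _ [:: s]); rewrite -catA.
    have := F 2; rewrite /rot /= drop0 take0; apply: fc_word_comm.
    exact/comm_equiv_catl/comm_equiv_swap.
  apply/fc_word_gapP => -[|a x] h y z /= [].
    move=> <- E sy; case/lastP: z E => [|z b].
      move=> /(congr1 (last s)); rewrite !last_cat /= => ts.
      by have := comm2_neq mst; rewrite ts eqxx.
    rewrite -rcons_cons -rcons_cat cats1 => /rcons_inj[E _].
    by move/fc_word_gapP: F1 => /(_ [::] s y z); apply; rewrite //= E.
  by move=> _ E hy; move/fc_word_gapP: F2 => /(_ x h y z); apply.
- apply: fc_word_comm (F k.+2); rewrite /rot /=; apply/comm_equiv_catl.
  exact: comm_equiv_swap.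
Qed.

Lemma cyc_fc_comm u v : comm_equiv u v -> cyc_fc u -> cyc_fc v.
Proof.
elim=> {u v} [_ _ [u v s t mst]|//|u v w _ IH1 _ IH2 /IH1/IH2//] F.
have := cyc_fc_rot (size u) F; rewrite rot_size_cat /= => /(cyc_fc_swap mst) {}F.
have := cyc_fc_rot (size (t :: s :: v)) F.
by rewrite -(rot_size_cat (t :: s :: v)).
Qed.

Lemma cyc_fc_cfc u : cyc_fc u -> cyclically_fully_commutative (cl u).
Proof.
move=> F v k vu; have Fu : fc_word m u by rewrite -[u]rot0; apply: F.
have Fv := cyc_fc_comm (fc_word_equiv Fu vu) F.
exists (cl (rot k v)); split; [exact: fc_word_reduced|exact: fc_word_fc].
Qed.

Lemma ex_reduced_expr (x : coxeter_group m) : exists u, reduced_expr u x.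
Proof.
have ex : exists k, `[< exists2 u, cox_prod m u = x & size u = k >].
  exists (size (repr x)); apply/asboolP; exists (repr x) => //.
  by rewrite cox_prodE cox_class_repr.
have [_ /asboolP[u ux <-] umin] := ex_minnP ex.
exists u; split=> // v vx; apply: umin; apply/asboolP; by exists v.
Qed.

End SimplyLaced.

(** * Alternating words *)

Section Alternation.
Variable T : eqType.
Implicit Types (a b c x y : T) (s w u v : seq T).

Lemma alternate_between a b u v w :
  alternate a b (u ++ a :: v ++ a :: w) -> b \in v.
Proof.
rewrite /alternate filter_cat /= eqxx /= filter_cat /= eqxx /= => /cat_sorted2[_] /=.
case E: [seq _ <- v | _] => [|c s] /=; first by rewrite eqxx.
have : c \in [seq x <- v | (x == a) || (x == b)] by rewrite E inE eqxx.
by rewrite mem_filter eq_sym => /andP[/orP[->//|/eqP->]].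
Qed.

Lemma alternateC a b w : alternate a b w = alternate b a w.
Proof. by rewrite /alternate; congr sorted; apply: eq_filter => x; rewrite orbC. Qed.

Lemma last_alternating a b c s : all (pred2 a b) (c :: s) ->
  path (fun x y => x != y) c s -> (last c s == c) = ~~ odd (size s).
Proof.
elim: s c => [|d s IH] c; first by rewrite eqxx.
rewrite /= => /andP[cab dsab] /andP[cd ps]; rewrite negbK.
have odds : odd (size s) = (last d s != d).
  by rewrite (IH d) ?negbK.
rewrite odds; have /orP lab := allP (dsab : all (pred2 a b) (d :: s)) _ (mem_last d s).
move: (last d s) lab => l lab.
case/andP: dsab => /orP dab _; case/orP: cab cd => /eqP->.
all: case: dab => /eqP->; case: lab => /eqP->; rewrite ?eqxx //.
all: by rewrite 1?eq_sym => /negPf->.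
Qed.

(** With as many [a] as [b], the first and the last of these letters differ, so
    the alternation closes up to a cycle. *)
Lemma alternate_rot a b w k : a != b -> alternate a b w ->
  count_mem a w = count_mem b w -> alternate a b (rot k w).
Proof.
move=> ab aw cab; rewrite /alternate in aw *; set P := fun x => (x == a) || (x == b) in aw *.
have -> : [seq x <- rot k w | P x] =
    rot (size [seq x <- take k w | P x]) [seq x <- w | P x].
  by rewrite -{3}(cat_take_drop k w) filter_cat rot_size_cat /rot filter_cat.
set s := [seq x <- w | P x] in aw *.
suff cs : cycle [rel x y | x != y] s.
  move: cs; rewrite -(rot_cycle (size [seq x <- take k w | P x])).
  by case: rot => // c r; rewrite /= rcons_path => /andP[].
have : all (pred2 a b) s by apply/allP => x; rewrite mem_filter => /andP[].
have sz : size s = (count_mem a w).*2.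
  rewrite -addnn {2}cab size_filter -count_predUI.
  rewrite [X in _ + X](_ : _ = 0) ?addn0 // -(count_pred0 w).
  by apply: eq_count => x /=; apply/negP => /andP[/eqP->]; rewrite (negPf ab).
case: s aw sz => // c s; rewrite [sorted _ _]/= => ps sz sab.
rewrite /cycle rcons_path ps /= (last_alternating sab ps).
by rewrite -[~~ odd (size s)]/(odd (size (c :: s))) sz odd_double.
Qed.

End Alternation.

(** * Levels of the diagram, balanced and alternating words *)

Section Levels.
Variable n : nat.
Hypothesis n2 : 1 < n.
Implicit Types (g h : dgen n) (w : seq (dgen n)).

(** Adjacency in the diagram, in the form in which the two leaves at an end behave
    like one more vertex of a path. *)
Definition adj g h : bool :=
  (collapse g == (collapse h).+1) || (collapse h == (collapse g).+1).

Lemma ltn_Sg (i : 'I_n.-1) : i.+1 < n.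
Proof. by have := ltn_ord i; lia. Qed.

Lemma bondedE g h : bonded (affineD_matrix n) g h = adj g h.
Proof.
have -> : bonded (affineD_matrix n) g h = (h != g) && (dedge g h || dedge h g).
  by rewrite /bonded /= /dmat eq_sym; case: eqP => //= _; case: ifP.
case: g => [||i||]; case: h => [||j||]; rewrite /adj /= ?eqxx //=.
all: try by apply/esym/negbTE; lia.
all: try (have := ltn_Sg i); try (have := ltn_Sg j); try lia.
by move=> _ _; rewrite !eqSS orbC; case: eqP => //= -[->]; apply/esym/negbTE; lia.
Qed.

Lemma affineD_m23 g h : g != h ->
  affineD_matrix n g h = 2 \/ affineD_matrix n g h = 3.
Proof. by rewrite /= /dmat => /negPf->; case: ifP; [right|left]. Qed.

Lemma adj_sym g h : adj g h = adj h g.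
Proof. by rewrite /adj orbC. Qed.

Lemma collapse_Sg h (i : 'I_n.-1) : (collapse h == i.+1) = (h == Sg i).
Proof.
have := ltn_Sg i; case: h => [||j||] //= ni; try by apply/negbTE; lia.
Qed.

Lemma collapse_le h : collapse h <= n.
Proof. by case: h => [||i||] //=; exact: ltnW (ltn_Sg i). Qed.

Definition level c w := count (fun h => collapse h == c) w.

Lemma levelE c w : count_mem c (map (@collapse n) w) = level c w.
Proof. by rewrite count_map. Qed.

Lemma level0 w : level 0 w = occ T1 w + occ T2 w.
Proof.
rewrite /level /occ; elim: w => //= g w ->.
have n0 : (n == 0) = false by lia.
by case: g => [||i||]; rewrite /= ?n0; lia.
Qed.

Lemma leveln w : level n w = occ U1 w + occ U2 w.
Proof.
rewrite /level /occ; elim: w => //= g w ->.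
case: g => [||i||]; rewrite /= ?eqxx; try lia.
by have := ltn_Sg i; case: eqP => /=; lia.
Qed.

Lemma levelS (i : 'I_n.-1) w : level i.+1 w = occ (Sg i) w.
Proof.
rewrite /level /occ; elim: w => //= g w ->; have := ltn_Sg i.
case: g => [||j||] /=; rewrite ?eqSS; try lia.
suff -> : (Sg j == Sg i) = (j == i :> nat) by [].
by apply/eqP/eqP => [[->]//|/val_inj->].
Qed.

Definition mid0 : 'I_n.-1 := Ordinal (ltac:(lia) : 0 < n.-1).

Lemma mid_level c : 0 < c < n -> exists i : 'I_n.-1, c = i.+1.
Proof. by move=> cn; exists (Ordinal (ltac:(lia) : c.-1 < n.-1)) => /=; lia. Qed.

Lemma balanced_level w c : balanced w -> c <= n -> level c w = occ (Sg mid0) w.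
Proof.
case=> E _ /(_ mid0 erefl)[t1 t2 u1 u2] cn.
have [->|c0] := posnP c; first by rewrite level0; lia.
have [->|cn'] := eqVneq c n; first by rewrite leveln; lia.
have [|i ->] := @mid_level c; first by lia.
by rewrite levelS; apply: E.
Qed.

Lemma alternating_rot w k : alternating w -> balanced w -> alternating (rot k w).
Proof.
case=> A t u bw; have [_ _ /(_ mid0 erefl)[t1 t2 u1 u2]] := bw; split.
- move=> i ni; rewrite map_rot; apply: alternate_rot (A i ni) _; first by lia.
  by rewrite !levelE !balanced_level // ltnW.
- by apply: alternate_rot => //; rewrite -/(occ _ w) -/(occ _ w); lia.
- by apply: alternate_rot => //; rewrite -/(occ _ w) -/(occ _ w); lia.
Qed.

(** Here [g] and [g'] are the two leaves at one end and [d] is the level of their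
    neighbour.  A gap of [g] contains [g'], and the neighbour occurs on each side
    of it. *)
Lemma alternating_end_gap g g' d u v w (s := u ++ g :: v ++ g :: w) :
  collapse g' = collapse g -> alternate g g' s ->
  alternate (collapse g) d (map (@collapse n) s) ->
  (forall h, collapse h = d -> adj g h) -> 1 < count (adj g) v.
Proof.
move=> gg' /alternate_between g'v; rewrite /s => A dadj.
case/splitPr: g'v A => v1 v2; rewrite -!catA /= !map_cat /= !map_cat /= !map_cat /= gg' => A.
have d1 : has (adj g) v1.
  have /mapP[h hv hd] := alternate_between A.
  by apply/hasP; exists h => //; apply: dadj.
have d2 : has (adj g) v2.
  rewrite -cat_cons catA in A.
  have /mapP[h hv hd] := alternate_between A.
  by apply/hasP; exists h => //; apply: dadj.
by rewrite count_cat /=; rewrite !has_count in d1 d2; lia.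
Qed.

Lemma alternating_fc w : alternating w -> fc_word (affineD_matrix n) w.
Proof.
case=> A t u; apply/fc_word_gapP => x s y z wE _.
rewrite (eq_count (bondedE s)); rewrite wE in A t u.
case: s A t u {wE} => [||i||] A t u.
- by apply: (alternating_end_gap (g' := T2) (d := 1) _ t (A 0 _)) => [||h];
    rewrite /adj /=; lia.
- rewrite alternateC in t.
  by apply: (alternating_end_gap (g' := T1) (d := 1) _ t (A 0 _)) => [||h];
    rewrite /adj /=; lia.
- have := A i.+1 (ltn_Sg i); have := A i (ltnW (ltn_Sg i)).
  rewrite alternateC map_cat /= map_cat /= => /alternate_between i0 /alternate_between i2.
  rewrite -!has_pred1 !has_count !count_map in i0 i2.
  apply: leq_trans (leq_add i0 i2) _; rewrite -count_predUI.
  rewrite [X in _ + X](_ : _ = 0) ?addn0; last first.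
    by rewrite -(count_pred0 y); apply: eq_count => h /=; lia.
  by apply: sub_count => h /=; rewrite /adj /=; lia.
- have nE : n.-1.+1 = n by lia.
  have := A n.-1 _; rewrite nE alternateC => A'.
  by apply: (alternating_end_gap (g' := U2) (d := n.-1) _ u (A' _)) => [||h];
    rewrite /adj /=; lia.
- have nE : n.-1.+1 = n by lia.
  have := A n.-1 _; rewrite nE alternateC => A'; rewrite alternateC in u.
  by apply: (alternating_end_gap (g' := U1) (d := n.-1) _ u (A' _)) => [||h];
    rewrite /adj /=; lia.
Qed.

End Levels.

(** * Chip firing on the diagram and the periodic word *)

Lemma mkseqD (T : Type) (f : nat -> T) i d :
  mkseq f (i + d) = mkseq f i ++ mkseq (fun k => f (i + k)) d.
Proof.
rewrite /mkseq iotaD map_cat add0n; congr (_ ++ _).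
by rewrite -{1}[i]addn0 iotaDl -map_comp.
Qed.

Ltac case_eqs := repeat (case: eqP => /= ?); lia.

Section Firing.
Variable n : nat.
Implicit Types (g h : dgen n) (w : seq (dgen n)) (r : dgen n -> nat).

Lemma adj_irr g : adj g g = false.
Proof. by rewrite /adj; lia. Qed.

Lemma count_adj g w : count (adj g) w =
  (if 0 < collapse g then level (collapse g).-1 w else 0) + level (collapse g).+1 w.
Proof.
rewrite /level; elim: w => [|h w] /=; first by case: ifP.
by move=> ->; move: (count _ w) (count _ w) => x y; rewrite /adj; case: ifP; lia.
Qed.

Hypothesis n2 : 1 < n.

(** Chip firing: [r h] is thought of as the number of neighbours of [h] read since
    the last [h]. *)
Definition step r g : dgen n -> nat :=
  fun h => if h == g then 0 else r h + adj g h.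

Definition final r w := foldl step r w.

(** Reading a letter only at charge 2 says that every gap inside [w] contains
    exactly two neighbours. *)
Fixpoint firing r w : bool :=
  if w is g :: w' then (r g == 2) && firing (step r g) w' else true.

Lemma firing_cat r u v : firing r (u ++ v) = firing r u && firing (final r u) v.
Proof. by elim: u r => //= g u IH r; rewrite IH andbA. Qed.

Lemma final_cat r u v : final r (u ++ v) = final (final r u) v.
Proof. exact: foldl_cat. Qed.

Lemma final_count r w g : firing r w ->
  final r w g + 2 * occ g w = r g + count (adj g) w.
Proof.
rewrite /occ; elim: w r => [|h w IH] r /=; first by lia.
move=> /andP[/eqP rh /IH]; rewrite /step (adj_sym g) (eq_sym h).
by case: eqP => [->|_]; rewrite ?rh ?adj_irr; move: (final _ _ _) => f /=; lia.
Qed.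

Lemma firing_fc r w : firing r w -> fc_word (affineD_matrix n) w.
Proof.
move=> rw; apply/fc_word_gapP => x s y z wE sy; rewrite (eq_count (bondedE n2 s)).
move: rw; rewrite wE firing_cat /= => /and3P[_ _].
rewrite firing_cat => /andP[/(final_count s) + /andP[/eqP rs _]].
by rewrite rs /occ (count_memPn sy) {1}/step eqxx; lia.
Qed.

Lemma level_gt c w : n < c -> level c w = 0.
Proof.
move=> nc; apply/eqP; rewrite -leqn0 leqNgt -has_count; apply/hasPn => g _.
case: g => [||i||] /=; try (have := ltn_Sg n2 i); lia.
Qed.

(** The vector (1, 1, 2, ..., 2, 1, 1) is a null vector of the Cartan matrix. *)
Lemma balanced_adj w g : balanced w -> count (adj g) w = 2 * occ g w.
Proof.
move=> bw; rewrite count_adj; have bl := balanced_level n2 bw.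
have [E _ /(_ (mid0 n2) erefl)[t1 t2 u1 u2]] := bw.
case: g => [||i||] /=; try by rewrite bl; lia.
- have li := ltn_Sg n2 i; by rewrite (E i (mid0 n2)) !bl; lia.
- by rewrite (level_gt _ (ltnSn n)) bl; [case: ifP|]; lia.
- by rewrite (level_gt _ (ltnSn n)) bl; [case: ifP|]; lia.
Qed.

(** Balance makes the final charges equal to the initial ones, so the firing
    sequence closes up and can be entered at any of its letters. *)
Lemma firing_cyc_fc r w : firing r w -> balanced w -> cyc_fc (affineD_matrix n) w.
Proof.
move=> rw bw k; apply: (@firing_fc (final r (take k w))).
have rE : final r w = r.
  by apply/funext => g; have := final_count g rw; rewrite balanced_adj //; lia.
move: rw rE; rewrite -{1 2}(cat_take_drop k w) firing_cat final_cat => /andP[f1 f2] E.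
by rewrite /rot firing_cat f2 E.
Qed.

(** The charges while a single wave of firings moves along the levels and is about
    to fire level [j]: [up] on its way from the [t]s to the [u]s, [down] on its way
    back. *)
Definition up j h := if collapse h == j then 2 else if (collapse h).+1 == j then 0 else 1.
Definition down j h := if collapse h == j then 2 else if collapse h == j.+1 then 0 else 1.

Lemma firing_up (s : seq 'I_n.-1) j : map val s = iota j (size s) ->
  firing (up j.+1) (map Sg s) /\ final (up j.+1) (map Sg s) = up (j + size s).+1.
Proof.
elim: s j => [|i s IH] j /=; first by rewrite addn0.
case=> ij /IH; have {}ij : i = j :> nat := ij; rewrite addSnnS.
suff -> : step (up j.+1) (Sg i) = up j.+2.
  by case=> -> ->; rewrite /up /= ij eqxx.
apply/funext => h; rewrite /step /up /adj /=.
case: eqP => [->|hi] /=; first by rewrite ij; case_eqs.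
have : collapse h != i.+1.
  apply/eqP; case: h hi => [||i'||] //= hi; have := ltn_Sg n2 i; try lia.
  by move=> _ [/val_inj E]; rewrite E in hi.
by move/eqP => hi'; case_eqs.
Qed.

Lemma firing_down (s : seq 'I_n.-1) j : map val s = rev (iota j (size s)) ->
  firing (down (j + size s)) (map Sg s) /\
  final (down (j + size s)) (map Sg s) = down j.
Proof.
elim: s => [|i s IH]; first by rewrite addn0.
rewrite [size _]/= -addn1 iotaD rev_cat /= => -[ij /IH]; have {}ij : i = j + size s :> nat := ij.
suff -> : step (down (j + (size s + 1))) (Sg i) = down (j + size s).
  by case=> -> ->; rewrite /down /= ij addnA addn1 eqxx.
apply/funext => h; rewrite /step /down /adj /=.
case: eqP => [->|hi] /=; first by rewrite ij; case_eqs.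
have : collapse h != i.+1.
  apply/eqP; case: h hi => [||i'||] //= hi; have := ltn_Sg n2 i; try lia.
  by move=> _ [/val_inj E]; rewrite E in hi.
by move/eqP => hi'; case_eqs.
Qed.

Definition tpair (a : bool) : seq (dgen n) := if a then [:: T2; T1] else [:: T1; T2].
Definition upair (b : bool) : seq (dgen n) := if b then [:: U2; U1] else [:: U1; U2].

Lemma firing_tpair a : firing (down 0) (tpair a) /\ final (down 0) (tpair a) = up 1.
Proof.
split; first by case: a; rewrite /= /step /down /adj /= ?eqxx.
by case: a; apply/funext => -[||i||]; rewrite /= /step /down /up /adj /=;
  try have := ltn_Sg n2 i; case_eqs.
Qed.

Lemma firing_upair b : firing (up n) (upair b) /\ final (up n) (upair b) = down n.-1.
Proof.
split.
  by case: b; rewrite /= /step /up /adj /= ?eqxx /= ?(ltn_eqF (ltnSn n)) ?(gtn_eqF (ltnSn n)).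
by case: b; apply/funext => -[||i||]; rewrite /= /step /down /up /adj /=;
  try have := ltn_Sg n2 i; case_eqs.
Qed.

(** One period of the word is one journey of the wave up and down the diagram. *)
Lemma firing_period a b : firing (down 0) (period n a b) /\ final (down 0) (period n a b) = down 0.
Proof.
rewrite /period -/(tpair a) -/(upair b).
have [t1 t2] := firing_tpair a; have [u1 u2] := firing_upair b.
have szE : size (enum 'I_n.-1) = n.-1 by rewrite size_enum_ord.
have [s1 s2] := @firing_up (enum 'I_n.-1) 0 (etrans (val_enum_ord _) (congr1 _ (esym szE))).
have [|d1 d2] := @firing_down (rev (enum 'I_n.-1)) 0.
  by rewrite map_rev val_enum_ord size_rev szE.
rewrite !firing_cat !final_cat t1 t2 s1 s2 szE add0n prednK ?u1 ?u2; last lia.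
by rewrite -map_rev; rewrite add0n size_rev szE in d1 d2; rewrite d1 d2.
Qed.

Lemma firing_periods a b q (w := flatten (mkseq (fun i => period n (a i) (b i)) q)) :
  firing (down 0) w /\ final (down 0) w = down 0.
Proof.
rewrite /w {w}; elim: q => [|q [IH1 IH2]] //.
rewrite mkseqS -cats1 flatten_cat /= cats0 firing_cat final_cat IH1 IH2.
exact: firing_period.
Qed.

Lemma size_period a b : size (period n a b) = period_len n.
Proof. by rewrite /period_len /period; case: a; case: b; rewrite !size_cat. Qed.

Lemma period_lenE : period_len n = n.+1.*2.
Proof. by rewrite /period_len /period !size_cat size_rev size_map size_enum_ord /=; lia. Qed.

Lemma periodic_flatten a b q : mkseq (periodic_word n a b) (q * period_len n) =
  flatten (mkseq (fun i => period n (a i) (b i)) q).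
Proof.
elim: q => [|q IH] //; rewrite mkseqS -cats1 flatten_cat [flatten [:: _]]cats0.
rewrite -IH mulSn addnC /mkseq iotaD map_cat; congr (_ ++ _).
apply: (@eq_from_nth _ T1); first by rewrite size_map size_iota size_period.
move=> i; rewrite size_map size_iota => iP; rewrite (nth_map 0) ?size_iota // nth_iota //.
rewrite /periodic_word add0n divnMDl; last by rewrite period_lenE.
by rewrite (divn_small iP) addn0 modnMDl modn_small.
Qed.

Lemma factor_firing w a b : factor_of w (periodic_word n a b) -> exists r, firing r w.
Proof.
case=> k wE; exists (final (down 0) (mkseq (periodic_word n a b) k)).
have [+ _] := firing_periods a b (k + size w); rewrite -periodic_flatten.
have le : k + size w <= (k + size w) * period_len n by rewrite period_lenE; nia.
by rewrite -{1}(subnKC le) !mkseqD !firing_cat -wE => /andP[/andP[]].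
Qed.

End Firing.

(** * Cyclic words unrolled to periodic sequences *)

Section Unrolling.
Variables (T : eqType) (x0 : T) (w : seq T).
Implicit Types (P : pred T).
Local Notation L := (size w).
Hypothesis L_gt0 : 0 < L.

Definition unroll k := nth x0 w (k %% L).
Local Notation p := unroll.

Definition prefix_count P k := count P (mkseq p k).

Lemma prefix_countS P k : prefix_count P k.+1 = prefix_count P k + P (p k).
Proof. by rewrite /prefix_count mkseqS -cats1 count_cat /= addn0. Qed.

Lemma unroll_period k m : p (k + m * L) = p k.
Proof. by rewrite /p addnC modnMDl. Qed.

Lemma unroll_mkseq : mkseq p L = w.
Proof.
apply: (@eq_from_nth _ x0); rewrite size_mkseq // => i iL.
by rewrite nth_mkseq // /p modn_small.
Qed.

Lemma prefix_count_add P i d :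
  prefix_count P (i + d) = prefix_count P i + count P (mkseq (fun k => p (i + k)) d).
Proof.
elim: d => [|d IH]; first by rewrite !addn0.
by rewrite addnS prefix_countS IH mkseqS -cats1 count_cat /= addn0 addnA.
Qed.

Lemma leq_prefix_count P i j : i <= j -> prefix_count P i <= prefix_count P j.
Proof. by move=> /subnKC <-; rewrite prefix_count_add leq_addr. Qed.

Lemma prefix_count_period P k m :
  prefix_count P (k + m * L) = prefix_count P k + m * count P w.
Proof.
elim: k => [|k IH]; last by rewrite addSn !prefix_countS IH unroll_period addnAC.
elim: m => [|m]; rewrite !add0n // => IH.
rewrite mulSn addnC prefix_count_add IH mulSnr; congr (_ + count P _).
rewrite -[RHS]unroll_mkseq; apply: eq_map => k.
by rewrite addnC unroll_period.
Qed.

Lemma unroll_rot i : rot (i %% L) w = mkseq (fun k => p (i + k)) L.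
Proof.
have iL : i %% L < L by rewrite ltn_mod.
apply: (@eq_from_nth _ x0); rewrite size_rot ?size_mkseq // => k kL.
rewrite nth_mkseq // /p /rot nth_cat size_drop nth_drop -modnDml.
move: (i %% L) iL => {}i iL; case: ltnP => h; first by rewrite modn_small //; lia.
rewrite nth_take; last by lia.
have -> : i + k = (k - (L - i)) + L by lia.
by rewrite modnDr modn_small //; lia.
Qed.

Lemma unroll_later g k : g \in w -> exists2 j, k <= j & p j = g.
Proof.
move=> gw; exists (index g w + k * L); first by nia.
by rewrite unroll_period /p modn_small ?index_mem // nth_index.
Qed.

Lemma unroll_last g k : 0 < prefix_count (pred1 g) k ->
  exists l, [/\ l < k, p l = g & prefix_count (pred1 g) k = (prefix_count (pred1 g) l).+1].
Proof.
elim: k => // k IH; rewrite prefix_countS /=; case: eqP => [pk _|_].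
  by exists k; rewrite addn1.
by rewrite addn0 => /IH[l [lk pl E]]; exists l; split=> //; apply: ltnW.
Qed.

Lemma unroll_next g k : g \in w -> exists j,
  [/\ k <= j, p j = g & prefix_count (pred1 g) j = prefix_count (pred1 g) k].
Proof.
move=> gw; have ex : exists d, p (k + d) == g.
  by have [j kj pj] := unroll_later k gw; exists (j - k); rewrite subnKC ?pj.
have [d /eqP pd dmin] := ex_minnP ex; exists (k + d); split=> //; first exact: leq_addr.
rewrite prefix_count_add; apply/eqP; rewrite -[X in _ == X]addn0 eqn_add2l -leqn0 leqNgt.
rewrite -has_count; apply/hasPn => _ /mapP[e + ->] /=; rewrite mem_iota /= => ed.
by apply/negP => /dmin; lia.
Qed.

End Unrolling.

(** * Letter counts and charges of a cyclically fully commutative word *)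

Section Balance.
Variable n : nat.
Hypothesis n2 : 1 < n.
Variable w : seq (dgen n).
Implicit Types (g h : dgen n).

(** By level, the counts are bounded by their largest value [M] at an inner level,
    since a leaf that occurs twice occurs at most half as often as its neighbour.
    At an inner level with count [M] the inequality is an equality, so [M] spreads
    to the adjacent levels and in the end everywhere. *)
Lemma convex_balanced : (exists g, 1 < occ g w) ->
  (forall g, 1 < occ g w -> 2 * occ g w <= count (adj g) w) -> balanced w.
Proof.
move=> [g0 g0_2] cvx.
have T1c := cvx T1; have T2c := cvx T2; have U1c := cvx U1; have U2c := cvx U2.
rewrite !count_adj /= in T1c T2c U1c U2c.
rewrite (level_gt n2 _ (ltnSn n)) addn0 (ltnW n2) in U1c U2c.
have mid c : 0 < c < n -> 1 < level c w -> 2 * level c w <= level c.-1 w + level c.+1 w.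
  case/(mid_level n2) => i ->; rewrite (levelS n2) => /cvx.
  by rewrite count_adj /=.
have [il ilE] : exists i : 'I_n.-1, n.-1 = i.+1 by apply: (mid_level n2); lia.
have l1 : level 1 w = occ (Sg (mid0 n2)) w by rewrite -(levelS n2).
have ll : level n.-1 w = occ (Sg il) w by rewrite ilE (levelS n2).
rewrite l1 in T1c T2c; rewrite ll in U1c U2c.
have [i0 i0_2] : exists i, 1 < occ (Sg i) w.
  case: g0 g0_2 => [||i||] g0_2.
  - by exists (mid0 n2); have := T1c g0_2; lia.
  - by exists (mid0 n2); have := T2c g0_2; lia.
  - by exists i.
  - by exists il; have := U1c g0_2; lia.
  - by exists il; have := U2c g0_2; lia.
have [im _ imax] := @arg_maxnP _ i0 xpredT (fun i => occ (Sg i) w) isT.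
set M := occ (Sg im) w in imax.
have M2 : 1 < M by apply: leq_trans i0_2 (imax i0 isT).
have half g i : (1 < occ g w -> 2 * occ g w <= occ (Sg i) w) -> 2 * occ g w <= M.
  by have := imax i isT; case: (ltnP 1 (occ g w)) => [_ iM /(_ isT)|]; lia.
have [tM1 tM2 uM1 uM2] : [/\ 2 * occ T1 w <= M, 2 * occ T2 w <= M,
    2 * occ U1 w <= M & 2 * occ U2 w <= M].
  by split; [exact: half T1c|exact: half T2c|exact: half U1c|exact: half U2c].
have leM c : c <= n -> level c w <= M.
  move=> cn; have [->|c0] := posnP c; first by rewrite (level0 n2); lia.
  have [->|cn'] := eqVneq c n; first by rewrite (leveln n2); lia.
  have [|i ->] := @mid_level n n2 c; first by lia.
  by rewrite (levelS n2); apply: imax.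
have nbrs c : 0 < c < n -> level c w = M -> level c.-1 w = M /\ level c.+1 w = M.
  move=> cn cM; have := mid c cn; rewrite cM => /(_ M2).
  by have := leM c.-1; have := leM c.+1; lia.
have imM : level im.+1 w = M by rewrite (levelS n2).
have imn := ltn_Sg n2 im.
have upM d : im.+1 + d <= n -> level (im.+1 + d) w = M.
  elim: d => [|d IH] dn; first by rewrite addn0.
  by rewrite addnS; apply: (nbrs _ _ (IH _)).2; lia.
have downM d : d <= im.+1 -> level (im.+1 - d) w = M.
  elim: d => [|d IH] dn; first by rewrite subn0.
  by rewrite subnS; apply: (nbrs _ _ (IH _)).1; lia.
have allM c : c <= n -> level c w = M.
  move=> cn; case: (leqP im.+1 c) => [ic|ic].
    by rewrite -(subnKC ic) upM // subnKC.
  by rewrite -(subKn (ltnW ic)) downM // leq_subr.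
have SgM i : occ (Sg i) w = M.
  by rewrite -(levelS n2) allM // ltnW // (ltn_Sg n2).
have := allM 0 isT; have := allM n (leqnn n); rewrite (level0 n2) (leveln n2) => nM oM.
by split=> [i j|i|i _]; rewrite !SgM //; split; lia.
Qed.

End Balance.

Section States.
Variable n : nat.
Hypothesis n2 : 1 < n.
Variable w : seq (dgen n).
Hypothesis cw : cyc_fc (affineD_matrix n) w.
Hypothesis repeated : exists g, 1 < occ g w.
Implicit Types (g h : dgen n).
Local Notation L := (size w).
Local Notation p := (unroll T1 w).
Local Notation c g := (prefix_count T1 w (pred1 g)).
Local Notation nb g := (prefix_count T1 w (adj g)).

Lemma size_w_gt0 : 0 < L.
Proof. by case: repeated; case: w => // g. Qed.
Local Notation L_gt0 := size_w_gt0.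

Lemma c_period g k m : c g (k + m * L) = c g k + m * occ g w.
Proof. exact: prefix_count_period. Qed.

Lemma nb_period g k m : nb g (k + m * L) = nb g k + m * count (adj g) w.
Proof. exact: prefix_count_period. Qed.

Lemma c_lt g i j : p i = g -> i < j -> c g i < c g j.
Proof.
move=> pi /(leq_prefix_count T1 w (pred1 g)).
by rewrite prefix_countS /= pi eqxx addn1.
Qed.

Lemma short_gap g i j : p i = g -> p j = g -> i < j -> j < i + L ->
  c g j = (c g i).+1 -> nb g i + 2 <= nb g j.
Proof.
move=> pi pj ij jL; pose d := (j - i).-1.
have jE : j = i + (1 + d) by rewrite /d; lia.
have LE : L = 1 + d + (1 + (L - d - 2)) by lia.
rewrite jE !prefix_count_add /mkseq !iotaD !map_cat !count_cat /= !addn0.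
rewrite pi eqxx adj_irr; set y := [seq p (i + k) | k <- iota _ d] => cy.
rewrite leq_add2l; change (1 < count (adj g) y).
have gy : g \notin y.
  by apply/count_memPn; move: cy; rewrite -addn1 => /addnI[].
have := cw (i %% L); rewrite (unroll_rot T1 L_gt0) LE /mkseq iotaD map_cat iotaD map_cat.
rewrite iotaD map_cat [map _ (iota _ 1)]/= [map _ (iota (0 + (1 + d)) 1)]/=.
rewrite add0n -jE pj addn0 pi => /fc_word_gapP/(_ [::] g y _ _ gy).
by rewrite (eq_count (bondedE n2 g)); apply.
Qed.

(** A gap shorter than [w] lies inside a rotation of [w]; a longer one contains a
    full turn, and then the second alternative of the hypothesis is what counts. *)
Lemma next_gap g i j : 1 < occ g w \/ 1 < count (adj g) w ->
  p i = g -> p j = g -> i < j -> c g j = (c g i).+1 -> nb g i + 2 <= nb g j.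
Proof.
move=> gg pi pj ij E; case: (ltnP j (i + L)) => [jL|Lj]; first exact: short_gap.
have := leq_prefix_count T1 w (pred1 g) Lj; have := leq_prefix_count T1 w (adj g) Lj.
by rewrite -[L in _ + L]mul1n c_period nb_period; case: gg; lia.
Qed.

Lemma nb_mono g i j : 1 < occ g w \/ 1 < count (adj g) w ->
  p i = g -> p j = g -> i <= j -> nb g i + 2 * c g j <= nb g j + 2 * c g i.
Proof.
move=> gg pi; elim/ltn_ind: j => j IH pj; rewrite leq_eqVlt => /orP[/eqP->|ij]; first by lia.
have [l [lj pl cl]] := unroll_last (leq_ltn_trans (leq0n _) (c_lt pi ij)).
have il : i <= l.
  rewrite leqNgt; apply/negP => li.
  by have := c_lt pl li; have := c_lt pi ij; rewrite cl ltnS leqNgt => /negP.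
by have := IH l lj pl il; have := next_gap gg pl pj lj cl; lia.
Qed.

Lemma cyc_fc_balanced : balanced w.
Proof.
apply: convex_balanced => // g g2; have gw : g \in w by rewrite -has_pred1 has_count; apply: ltnW.
have [i _ pi] := unroll_later T1 L_gt0 0 gw.
have := @nb_mono g i (i + 1 * L) (or_introl g2) pi.
rewrite unroll_period pi c_period nb_period leq_addr => /(_ erefl isT).
lia.
Qed.

Lemma all_occur g : 0 < occ g w.
Proof.
have [E ge2 /(_ (mid0 n2) erefl)[]] := cyc_fc_balanced.
have := ge2 (mid0 n2); case: g => [||i||]; rewrite ?(E i (mid0 n2)); lia.
Qed.

Lemma all_in g : g \in w.
Proof. by rewrite -has_pred1 has_count all_occur. Qed.

(** Along the occurrences of [g] the difference [nb g - 2 * c g] does not decrease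
    by the gap condition, and it is periodic by balance. *)
Lemma nb_const g i j : p i = g -> p j = g ->
  nb g i + 2 * c g j = nb g j + 2 * c g i.
Proof.
move=> pi pj; have bg := balanced_adj n2 g cyc_fc_balanced.
have gg : 1 < occ g w \/ 1 < count (adj g) w by right; rewrite bg; have := all_occur g; lia.
suff le a b : p a = g -> p b = g -> nb g a + 2 * c g b <= nb g b + 2 * c g a.
  by apply/eqP; rewrite eqn_leq !le.
move=> pa pb; have := @nb_mono g a (b + a * L) gg pa.
rewrite unroll_period pb !c_period !nb_period bg.
have ab : a <= b + a * L by have := L_gt0; nia.
by move=> /(_ erefl ab); lia.
Qed.

(** The number of neighbours of [g] among the letters between the last [g] and
    time [k], expressed by prefix counts that are normalised at the first
    occurrence of [g]; by [charge_bounds] the truncated subtraction is exact. *)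
Definition charge k g : nat :=
  2 + nb g k + 2 * c g (index g w) - (2 * c g k + nb g (index g w)).

Lemma unroll_index g : p (index g w) = g.
Proof. by rewrite /unroll modn_small ?index_mem ?all_in // nth_index ?all_in. Qed.

(** Compare time [k] with the next occurrence of [g] for the first bound and, one
    turn later, with the previous one for the second. *)
Lemma charge_bounds g k (x := index g w) :
  nb g k + 2 * c g x <= 2 * c g k + nb g x /\
  2 * c g k + nb g x <= 2 + nb g k + 2 * c g x.
Proof.
have px : p x = g := unroll_index g; split.
  have [j [kj pj cj]] := unroll_next T1 L_gt0 k (all_in g).
  have := leq_prefix_count T1 w (adj g) kj; have := nb_const pj px; lia.
have bg := balanced_adj n2 g cyc_fc_balanced.
have c0 : 0 < c g (k + 1 * L).
  by rewrite c_period; have := all_occur g; lia.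
have [l [lk pl cl]] := unroll_last c0.
have := leq_prefix_count T1 w (adj g) (ltnW lk); have := nb_const pl px.
move: cl; rewrite !c_period !nb_period bg; lia.
Qed.

Lemma charge_le2 k g : charge k g <= 2.
Proof. by have := charge_bounds g k; rewrite /charge; lia. Qed.

Lemma charge_fires k : charge k (p k) = 2.
Proof.
by have := nb_const (erefl (p k)) (unroll_index (p k)); rewrite /charge; lia.
Qed.

Lemma charge_step k : charge k.+1 = step (charge k) (p k).
Proof.
apply/funext => g; have := charge_bounds g k.+1; have := charge_bounds g k.
rewrite /step /charge !prefix_countS /= (adj_sym (p k)) (eq_sym (p k)).
case: eqP => [->|_] /=; last by lia.
have := nb_const (erefl (p k)) (unroll_index (p k)); rewrite adj_irr; lia.
Qed.

Lemma charge_period k m : charge (k + m * L) = charge k.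
Proof.
apply/funext => g; have bg := balanced_adj n2 g cyc_fc_balanced.
by rewrite /charge !c_period !nb_period bg; lia.
Qed.

End States.

(** * The two kinds of recurrent firing sequences *)

(** The runs [x] of the two-state automaton for the alternation of [a] and [b]:
    [a] is read in state [true] and [b] in state [false]. *)
Definition toggles (T : eqType) (f : nat -> T) a b (x : nat -> bool) := forall k,
  if f k == a then x k && ~~ x k.+1
  else if f k == b then ~~ x k && x k.+1 else x k.+1 == x k.

Lemma toggles_alternate (T : eqType) (f : nat -> T) a b x m :
  a != b -> toggles f a b x -> alternate a b (mkseq f m).
Proof.
move=> ab tx; set P := fun y => (y == a) || (y == b).
suff : alternate a b (mkseq f m) /\
    (forall c s, [seq y <- mkseq f m | P y] = c :: s ->
       last c s = if x m then b else a) by case.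
elim: m => [//|m [al la]]; rewrite mkseqS /alternate filter_rcons -/P.
rewrite /alternate -/P in al; have := tx m; rewrite {2}/P.
have [fa /andP[xm /negPf->]|fa] := eqVneq (f m) a; last first.
  have [fb /andP[/negPf xm ->]|fb] := eqVneq (f m) b; last first.
    by move/eqP->.
  case: [seq y <- _ | _] al la => [|c s] al la; first by split=> // c s [<- <-].
  split; last by move=> c' s'; rewrite rcons_cons => -[<- <-]; rewrite last_rcons.
  by rewrite rcons_cons /= rcons_path; apply/andP; split=> //=; rewrite (la _ _ erefl) xm fb.
case: [seq y <- _ | _] al la => [|c s] al la; first by split=> // c s [<- <-].
split; last by move=> c' s'; rewrite rcons_cons => -[<- <-]; rewrite last_rcons.
by rewrite rcons_cons /= rcons_path; apply/andP; split=> //=; rewrite (la _ _ erefl) xm fa eq_sym.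
Qed.

Section Dynamics.
Variable n : nat.
Hypothesis n2 : 1 < n.
Variables (p : nat -> dgen n) (r : nat -> dgen n -> nat) (L : nat).
Hypothesis L_gt0 : 0 < L.
Hypothesis r_fires : forall k, r k (p k) = 2.
Hypothesis r_step : forall k, r k.+1 = step (r k) (p k).
Hypothesis r_le2 : forall k g, r k g <= 2.
Hypothesis r_period : forall k m, r (k + m * L) = r k.
Hypothesis p_period : forall k m, p (k + m * L) = p k.
Hypothesis p_all : forall g, exists2 i, i < L & p i = g.
Implicit Types (g h : dgen n).

Lemma r_after k : r k.+1 (p k) = 0.
Proof. by rewrite r_step /step eqxx. Qed.

Lemma rS k h : h != p k -> r k.+1 h = r k h + adj (p k) h.
Proof. by rewrite r_step /step => /negPf->. Qed.

Lemma next_fire g k : exists j, [/\ k <= j, p j = g & forall l, k <= l < j -> p l != g].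
Proof.
have [i iL pi] := p_all g.
have ex : exists d, p (k + d) == g.
  exists (i + k * L - k); rewrite subnKC; last by nia.
  by rewrite p_period pi.
have [d /eqP pd dmin] := ex_minnP ex; exists (k + d); split=> //; first exact: leq_addr.
move=> l /andP[kl lk]; apply/negP => pl.
by have := dmin (l - k); rewrite subnKC // => /(_ pl); lia.
Qed.

Lemma prev_fire g k : L <= k ->
  exists i, [/\ i < k, p i = g & forall l, i < l < k -> p l != g].
Proof.
move=> Lk; have [i iL pi] := p_all g.
have ex : exists i, (i < k) && (p i == g) by exists i; rewrite pi eqxx andbT; lia.
have ub j : (j < k) && (p j == g) -> j <= k by case/andP => /ltnW.
have [j /andP[jk /eqP pj] jmax] := ex_maxnP ex ub; exists j; split=> // l /andP[jl lk].
by apply/negP => pl; have := jmax l; rewrite lk pl => /(_ isT); lia.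
Qed.

Lemma r_count g i d : (forall l, i <= l < i + d -> p l != g) ->
  r (i + d) g = r i g + count (adj g) (mkseq (fun k => p (i + k)) d).
Proof.
elim: d => [|d IH] no; first by rewrite !addn0.
rewrite addnS rS; last by rewrite eq_sym no //; lia.
rewrite IH; last by move=> l lid; apply: no; lia.
by rewrite mkseqS -cats1 count_cat /= addn0 adj_sym addnA.
Qed.

Lemma r_mono g i j : i <= j -> (forall l, i <= l < j -> p l != g) -> r i g <= r j g.
Proof. by move=> /subnKC <- no; rewrite r_count // leq_addr. Qed.

Lemma r_incr g k : adj g (p k) -> r k.+1 g = (r k g).+1.
Proof.
move=> a; rewrite rS; first by rewrite adj_sym a addn1.
by apply: contraTneq a => ->; rewrite adj_irr.
Qed.

(** A gap of [g] that surrounds the time [k] and avoids [h] lies inside a gap of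
    [h]; its left end [a] is a parameter so that it can be moved by whole turns. *)
Definition nested g h a k := exists b, [/\ a < k <= b, p a = g, p b = g,
  forall l, a < l < b -> p l != h & forall l, a < l < b -> p l != g].

Lemma nested_period g h a k m : nested g h a k -> nested g h (a + m * L) (k + m * L).
Proof.
case=> b [akb pa pb noh nog]; exists (b + m * L).
have no f : (forall l, a < l < b -> p l != f) ->
    forall l, a + m * L < l < b + m * L -> p l != f.
  move=> nof l alb; have := nof (l - m * L); rewrite -(p_period _ m) subnK; last by lia.
  by apply; lia.
by rewrite !p_period; split; [lia|..]; auto.
Qed.

(** The gap of [h] around [k] contains the two letters [g] at the ends of the given
    gap, hence no other neighbour of [h]: only the first of the two precedes [k],
    and [h'] is absent, so the situation recurs one bond further. *)
Lemma nested_next g h a k : adj g h -> L <= a -> nested g h a k ->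
  r k h = 1 /\
  forall h', adj h h' -> h' != g -> exists a', nested h h' a' k.
Proof.
move=> gh La [b [akb pa pb noh _]].
have hg : g != h by apply: contraTneq gh => ->; rewrite adj_irr.
have [a' [a'a pa' noh']] := prev_fire h La.
have noh2 l : a' < l <= b -> p l != h.
  move=> la; have [->|la1] := eqVneq l a; first by rewrite pa.
  have [->|lb1] := eqVneq l b; first by rewrite pb.
  by case: (ltnP l a) => ?; [apply: noh'|apply: noh]; lia.
have mono i j : a' < i -> i <= j -> j <= b.+1 -> r i h <= r j h.
  by move=> ai ij jb; apply: r_mono => // l lij; apply: noh2; lia.
have ra : r a.+1 h = (r a h).+1 by apply: r_incr; rewrite pa adj_sym.
have rb : r b.+1 h = (r b h).+1 by apply: r_incr; rewrite pb adj_sym.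
have ab : r a.+1 h <= r b h by apply: mono; lia.
have ak : r a.+1 h <= r k h by apply: mono; lia.
have kb : r k h <= r b h by apply: mono; lia.
have b2 := r_le2 b.+1 h; split; first by lia.
move=> h' hh' h'g; have [b' [bb' pb' nohb]] := next_fire h b.
exists a', b'; split; first by lia.
- by [].
- by [].
- move=> l lab; apply/eqP => pl.
  have rl : r l.+1 h = (r l h).+1 by apply: r_incr; rewrite pl.
  have la : l != a by apply: contraNneq h'g => E; rewrite -pl E pa.
  have lb : l != b by apply: contraNneq h'g => E; rewrite -pl E pb.
  case: (ltnP l a) => la1.
    by have : r l.+1 h <= r a h by [apply: mono; lia]; lia.
  case: (ltnP l b) => lb1.
    have : r l.+1 h <= r b h by apply: mono; lia.
    have : r a.+1 h <= r l h by apply: mono; lia.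
    by lia.
  have : r b.+1 h <= r l h.
    apply: r_mono => [|i ib]; first by lia.
    by apply: nohb; lia.
  by have := r_le2 l.+1 h; lia.
- move=> l lab; case: (leqP l b) => lb; first by apply: noh2; lia.
  by apply: nohb; lia.
Qed.

Section End.
Variables (v v' g : dgen n).
Hypothesis adj_v : forall h, adj v h = (h == g).

Lemma end_noincr i j : i <= j -> (forall l, i <= l < j -> p l != g) -> r j v <= r i v.
Proof.
move=> /subnKC <-; elim: (j - i) => [|d IH] no; first by rewrite addn0.
rewrite addnS; have [<-|nv] := eqVneq (p (i + d)) v; first by rewrite r_after.
rewrite rS 1?eq_sym // adj_sym adj_v (negPf (no _ _)) ?addn0; last by lia.
by apply: IH => l lid; apply: no; lia.
Qed.

(** Otherwise the next [g] would raise the charge of [v] beyond 2. *)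
Lemma full_end_fires a b : p b = g -> a < b -> r a.+1 v = 2 ->
  exists2 l, a < l < b & p l = v.
Proof.
move=> pb ab ra; apply: contrapT => no.
have : r a.+1 v <= r b v.
  by apply: r_mono => // l lab; apply/eqP => pl; apply: no; exists l.
by have := r_le2 b.+1 v; rewrite r_incr ?pb ?adj_v // ra; lia.
Qed.
Hypothesis adj_v' : forall h, adj v' h = (h == g).
Hypothesis vv' : v != v'.

(** Reading a leaf changes its charge by 2, and reading [g] changes both charges
    by 1. *)
Lemma end_parity k : odd (r k v + r k v') = odd (r 0 v + r 0 v').
Proof.
elim: k => // k <-; have [E|nv] := eqVneq (p k) v.
  rewrite -E r_after r_fires rS ?E 1?eq_sym //.
  by rewrite adj_v -adj_v' adj_irr addn0 !oddD.
have [E|nv'] := eqVneq (p k) v'.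
  rewrite -E r_after r_fires rS ?E //.
  by rewrite adj_v' -adj_v adj_irr addn0 !oddD /= addbF.
rewrite !rS 1?eq_sym // ![adj (p k) _]adj_sym adj_v adj_v' !oddD.
by case: (p k == g) => /=; case: (odd _); case: (odd _).
Qed.

(** Take the last [g] before an occurrence of [v]: it brings the charge of [v] to
    2 and that of [v'] to a positive even number. *)
Lemma even_end_full : ~~ odd (r 0 v + r 0 v') ->
  exists a, [/\ L <= a, p a = g, r a.+1 v = 2 & r a.+1 v' = 2].
Proof.
(* Two turns of past guarantee that the last [g] comes after a full turn. *)
move=> ev; have [j [Lj pj _]] := next_fire v (L + L).
have Lj' : L <= j by lia.
have [a [aj pa nog]] := prev_fire g Lj'.
have ra : r a.+1 v = 2.
  have : r j v <= r a.+1 v by apply: end_noincr.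
  have rj : r j v = 2 by rewrite -pj r_fires.
  by have := r_le2 a.+1 v; lia.
have ra' : r a.+1 v' = (r a v').+1 by apply: r_incr; rewrite pa adj_v'.
exists a; split=> //; last first.
  move: ev; rewrite -(end_parity a.+1) ra oddD /= => ev.
  by have := r_le2 a.+1 v'; rewrite ra' in ev *; case: (r a v') ev => [|[|]].
rewrite leqNgt; apply/negP => aL.
have [i iL pi] := p_all g.
by have := nog (i + 1 * L); rewrite p_period pi eqxx mul1n => /(_ ltac:(lia)).
Qed.

End End.

(** After a moment when t_1 and t_2 both have charge 2, both are read before the
    next s_1 and use up its gap, so that this gap avoids s_2.  From there the gaps
    of s_2, s_3, ... are nested in one another, and the charge is 1 from level 2
    on. *)
Lemma even_down0 : ~~ odd (r 0 T1 + r 0 T2) -> exists k, r k = down 0.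
Proof.
pose s1 := Sg (mid0 n2) : dgen n.
have adjT1 h : adj T1 h = (h == s1) by rewrite -(collapse_Sg n2).
have adjT2 h : adj T2 h = (h == s1) by rewrite -(collapse_Sg n2).
move=> /(even_end_full adjT1 adjT2 isT)[a [La pa r1 r2]].
have [b [ab pb nob]] := next_fire s1 a.+1; exists a.+1.
have noh h : adj s1 h -> h != T1 -> h != T2 -> forall l, a < l < b -> p l != h.
  move=> sh h1 h2 l lab; apply/eqP => pl.
  have [l1 ab1 pl1] := full_end_fires adjT1 pb ab r1.
  have [l2 ab2 pl2] := full_end_fires adjT2 pb ab r2.
  have := @r_count s1 a.+1 (b - a.+1); rewrite subnKC // => /(_ nob) rE.
  have := r_le2 b s1; rewrite rE leqNgt => /negP[]; rewrite ltn_addl //.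
  rewrite -size_filter; apply: (@uniq_leq_size _ [:: T1; T2; h]).
    by rewrite /= !inE !negb_or ![_ == h]eq_sym h1 h2.
  have inl x i : adj s1 x -> a < i < b -> p i = x ->
      x \in [seq y <- mkseq (fun k => p (a.+1 + k)) (b - a.+1) | adj s1 y].
    move=> sx iab px; rewrite mem_filter sx; apply/mapP; exists (i - a.+1).
      by rewrite mem_iota; lia.
    by rewrite subnKC //; case/andP: iab.
  move=> x; rewrite !inE => /or3P[] /eqP->.
  - by apply: inl pl1; rewrite // adj_sym adjT1.
  - by apply: inl pl2; rewrite // adj_sym adjT2.
  - exact: inl pl.
have chain c g h : 0 < c < n -> collapse g = c -> collapse h = c.+1 ->
    exists m a', nested g h a' (a.+1 + m * L).
  elim: c g h => // c IH g h cn gc hc.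
  have [c0|c0] := posnP c.
    have gs : g = s1 by apply/eqP; rewrite -(collapse_Sg n2) gc c0.
    exists 0, a, b; rewrite gs; split=> //; first by lia.
    apply: noh; first by rewrite /adj hc c0.
      by apply: contra_eqN hc => /eqP->.
    by apply: contra_eqN hc => /eqP->.
  have [|i iE] := @mid_level n n2 c; first by lia.
  have [|||m [a' N]] := IH (Sg i) g; rewrite ?gc //=; first by lia.
  (* Each step along the chain looks back for one more occurrence, which a shift
     by one turn makes available. *)
  have La' : L <= a' + 1 * L by lia.
  have gi : adj (Sg i) g by rewrite /adj gc /= -iE eqxx orbT.
  have [_ nx] := nested_next gi La' (nested_period 1 N).
  have gh : adj g h by rewrite /adj hc gc eqxx orbT.
  have hi : h != Sg i by apply: contra_eqN hc => /eqP->; rewrite /= -iE; lia.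
  have [a'' N'] := nx h gh hi.
  by exists m.+1, a''; rewrite mulSnr addnA -[X in _ + X]mul1n.
apply/funext => h; rewrite /down.
case: eqP => [|h0]; first by case: h => [||i||] //= n0; lia.
case: eqP => [h1|h1].
  have -> : h = s1 by apply/eqP; rewrite -(collapse_Sg n2) h1.
  by rewrite -pa r_after.
have hn : collapse h <= n by case: h {h0 h1} => [||i||] //=; have := ltn_Sg n2 i; lia.
have [|i iE] := @mid_level n n2 (collapse h).-1; first by lia.
have [|||m [a' N]] := @chain (collapse h).-1 (Sg i) h; rewrite ?prednK //=; try lia.
have La' : L <= a' + 1 * L by lia.
have gi : adj (Sg i) h by rewrite /adj /=; lia.
by have [] := nested_next gi La' (nested_period 1 N); rewrite !r_period.
Qed.

Lemma firing_run k d : firing (r k) (mkseq (fun i => p (k + i)) d) /\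
  final (r k) (mkseq (fun i => p (k + i)) d) = r (k + d).
Proof.
elim: d => [|d [IH1 IH2]]; first by rewrite addn0.
rewrite mkseqS -cats1 firing_cat final_cat IH1 IH2 /= r_fires eqxx.
by rewrite addnS r_step.
Qed.

Local Notation level_word := (fun k => collapse (p k)).

Lemma rE k h : r k.+1 h = if h == p k then 0 else r k h + adj (p k) h.
Proof. by rewrite r_step. Qed.

(** The sum of the two charges is 1 or 3; a leaf is read at 3 and their neighbour
    at 1. *)
Lemma odd_toggles0 : odd (r 0 T1 + r 0 T2) ->
  toggles level_word 0 1 (fun k => 2 < r k T1 + r k T2).
Proof.
pose s1 := Sg (mid0 n2) : dgen n.
have adjT1 h : adj T1 h = (h == s1) by rewrite -(collapse_Sg n2).
have adjT2 h : adj T2 h = (h == s1) by rewrite -(collapse_Sg n2).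
move=> o k; have {}o : odd (r k T1 + r k T2).
  by rewrite (end_parity adjT1 adjT2).
have := r_le2 k.+1 T1; have := r_le2 k.+1 T2; have := r_le2 k T1; have := r_le2 k T2.
have := r_fires k; rewrite !rE; case: (p k) => [||i||] rk /=.
- by rewrite rk /adj /= in o *; case: (r k T2) o => [|[|[|]]].
- by rewrite rk /adj /= in o *; case: (r k T1) o => [|[|[|]]].
- rewrite /adj /= orbF !eqSS; case: (i == 0 :> nat) => /=.
    by case: (r k T1) o => [|[|[|]]]; case: (r k T2) => [|[|[|]]].
  by rewrite !addn0.
- by rewrite /adj /= (gtn_eqF (ltnW n2)) (gtn_eqF n2) /= !addn0.
- by rewrite /adj /= (gtn_eqF (ltnW n2)) (gtn_eqF n2) /= !addn0.
Qed.

(** Let [s] be the letter of level [c.+1].  The new state is the charge of [s] plus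
    the old state, minus 1, and the point is that this sum is never 3 nor 0.
    A sum of 3 is a dead end: [s] itself needs the old state 0, and every other
    letter that could change the situation would raise the charge of [s] to 3.
    A sum of 0 is unreachable: [s] leaves the old state at 1, and the letter that
    resets this state adds 1 to the charge of [s]. *)
Lemma toggles_next c x : c.+1 < n ->
  toggles level_word c c.+1 x -> (forall k m, x (k + m * L) = x k) ->
  exists2 x', toggles level_word c.+1 c.+2 x' & forall k m, x' (k + m * L) = x' k.
Proof.
move=> cn tx px; have [|i iE] := @mid_level n n2 c.+1; first by lia.
pose s := Sg i : dgen n.
have sE k : (collapse (p k) == c.+1) = (p k == s) by rewrite iE collapse_Sg.
have sc : (collapse s == c) = false by rewrite /= -iE; lia.
have adjs h : adj h s = (collapse h == c) || (collapse h == c.+2).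
  by rewrite /adj /= -iE eqSS orbC eq_sym.
have keep l : p l != s -> r l.+1 s =
    r l s + ((collapse (p l) == c) || (collapse (p l) == c.+2)).
  by move=> pl; rewrite -adjs rS 1?eq_sym.
have le2 k : r k s + x k <= 2.
  rewrite leqNgt; apply/negP => bad.
  have [j [kj pj no]] := next_fire s k.
  suff H d : k + d <= j -> 2 < r (k + d) s + x (k + d).
    have := H (j - k); rewrite subnKC // => /(_ (leqnn _)).
    have rj : r j s = 2 by rewrite -pj r_fires.
    by have := tx j; rewrite sE pj eqxx sc rj => /andP[/negPf-> _].
  elim: d => [|d IH] dj; first by rewrite addn0.
  have nos : p (k + d) != s by apply: no; lia.
  have {IH} := IH ltac:(lia); have := tx (k + d); have := r_le2 (k + d).+1 s.
  rewrite addnS sE (negPf nos) keep //.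
  by case: eqP => /= _; case: (x _); case: (x _) => //=; lia.
have ge1 k : 1 <= r k s + x k.
  rewrite -(r_period k 1) -(px k 1) mul1n.
  have [a [aj pa no]] := prev_fire s (leq_addl k L).
  suff H d : a.+1 + d <= k + L -> 1 <= r (a.+1 + d) s + x (a.+1 + d).
    by have := H (k + L - a.+1); rewrite subnKC // => /(_ (leqnn _)).
  elim: d => [|d IH] dj.
    rewrite addn0; have := tx a; rewrite sE pa eqxx sc addn_gt0.
    by case/andP=> _ ->; rewrite orbT.
  have nos : p (a.+1 + d) != s by apply: no; lia.
  have {IH} := IH ltac:(lia); have := tx (a.+1 + d).
  rewrite addnS sE (negPf nos) keep //.
  by case: eqP => /= _; case: (x _); case: (x _) => //=; lia.
exists (fun k => 1 < r k s + x k); last by move=> k m; rewrite r_period px.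
move=> k; have := tx k; have := le2 k.+1; have := ge1 k.+1; have := le2 k; have := ge1 k.
rewrite sE; have [pk|pk] := eqVneq (p k) s.
  have -> : r k s = 2 by rewrite -pk r_fires.
  have -> : r k.+1 s = 0 by rewrite -pk r_after.
  by rewrite pk sc; case: (x k) => //=; case: (x k.+1).
rewrite keep //; have [pc|pc] := eqVneq (collapse (p k)) c.
  rewrite pc (ltn_eqF (ltnW (ltnSn c.+1))) /=; case: (x k) => //=; case: (x k.+1) => //=.
  by rewrite !addn0 addn1.
by case: (collapse (p k) == c.+2) => /=; case: (x k); case: (x k.+1) => //=; lia.
Qed.

Lemma odd_toggles c : odd (r 0 T1 + r 0 T2) -> c < n ->
  exists2 x, toggles level_word c c.+1 x & forall k m, x (k + m * L) = x k.
Proof.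
move=> o; elim: c => [|c IH] cn.
  by eexists; [exact: odd_toggles0|move=> k m /=; rewrite !r_period].
by have [x tx px] := IH (ltnW cn); apply: toggles_next tx px.
Qed.

(** With charges of different parity the larger one decides which leaf is next. *)
Lemma odd_end_toggles (v v' g : dgen n) :
  (forall h, adj v h = (h == g)) -> (forall h, adj v' h = (h == g)) -> v != v' ->
  odd (r 0 v + r 0 v') -> toggles p v v' (fun k => r k v' < r k v).
Proof.
move=> av av' vv' o k; have {}o : odd (r k v + r k v') by rewrite (end_parity av av').
have := r_le2 k.+1 v; have := r_le2 k.+1 v'; have := r_le2 k v; have := r_le2 k v'.
have vg : (v == g) = false by rewrite -av adj_irr.
have v'g : (v' == g) = false by rewrite -av' adj_irr.
rewrite !rE [adj _ v]adj_sym [adj _ v']adj_sym av av' ![_ == p k]eq_sym.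
have [E|nv] := eqVneq (p k) v.
  have rv : r k v = 2 by rewrite -E r_fires.
  rewrite E (negPf vv') vg addn0 /= rv in o *.
  by case: (r k v') o => [|[|[|]]].
have [E|nv'] := eqVneq (p k) v'.
  have rv : r k v' = 2 by rewrite -E r_fires.
  rewrite E v'g addn0 /= rv in o *.
  by case: (r k v) o => [|[|[|]]].
by rewrite ltn_add2r.
Qed.

(** If the parity were even at the other end, both [u]s would be read between two
    consecutive letters of level [n.-1], against the alternation that has
    propagated to the levels [n.-1] and [n]. *)
Lemma odd_other_end : odd (r 0 T1 + r 0 T2) -> odd (r 0 U1 + r 0 U2).
Proof.
move=> o; apply/negPn/negP => ev; have [|i iE] := @mid_level n n2 n.-1; first by lia.
pose g := Sg i : dgen n.
have adjU h : (collapse h == n.-1) = (h == g) by rewrite iE collapse_Sg.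
have adjU1 h : adj U1 h = (h == g).
  by rewrite -adjU /adj /=; have := collapse_le n2 h; lia.
have adjU2 h : adj U2 h = (h == g).
  by rewrite -adjU /adj /=; have := collapse_le n2 h; lia.
have [a [_ pa r1 r2]] := even_end_full adjU1 adjU2 isT ev.
have [b [ab pb nob]] := next_fire g a.+1.
have [l1 lb1 pl1] := full_end_fires adjU1 pb ab r1.
have [l2 lb2 pl2] := full_end_fires adjU2 pb ab r2.
have [x tx _] := odd_toggles o (ltac:(lia) : n.-1 < n).
(* The state of the alternation of the levels [n.-1] and [n] would stay 1 from
   the first reading of a [u] to the second. *)
have clash i1 i2 : a < i1 -> i1 < i2 -> i2 < b ->
    collapse (p i1) = n -> collapse (p i2) = n -> False.
  move=> ai1 i12 i2b c1 c2; have nE : n.-1.+1 = n by lia.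
  have ne : (n == n.-1) = false by lia.
  have := tx i2; rewrite c2 nE ne eqxx => /andP[/negP x2 _]; apply: x2.
  suff H d : i1.+1 + d <= i2 -> x (i1.+1 + d).
    by have := H (i2 - i1.+1); rewrite subnKC // => /(_ (leqnn _)).
  elim: d => [|d IH] di.
    by rewrite addn0; have := tx i1; rewrite c1 nE ne eqxx => /andP[].
  have {IH} := IH ltac:(lia); have := tx (i1.+1 + d); rewrite addnS adjU.
  rewrite (negPf (nob _ _)); last by lia.
  by case: eqP => _; [case/andP|move/eqP->].
case: (ltngtP l1 l2) => [l12|l21|E].
- by apply: (clash l1 l2); rewrite ?pl1 ?pl2 //; lia.
- by apply: (clash l2 l1); rewrite ?pl1 ?pl2 //; lia.
- by move: pl2; rewrite -E pl1.
Qed.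

Lemma odd_alternating : odd (r 0 T1 + r 0 T2) -> alternating (mkseq p L).
Proof.
move=> o; split.
- move=> i ni; have [x tx _] := odd_toggles o ni.
  have -> : map (@collapse n) (mkseq p L) = mkseq level_word L by rewrite /mkseq -map_comp.
  by apply: toggles_alternate tx; lia.
- apply: toggles_alternate (odd_end_toggles (g := Sg (mid0 n2)) _ _ _ o) => //.
  + by move=> h; rewrite -(collapse_Sg n2).
  + by move=> h; rewrite -(collapse_Sg n2).
- have [|i iE] := @mid_level n n2 n.-1; first by lia.
  apply: toggles_alternate (odd_end_toggles (g := Sg i) _ _ _ (odd_other_end o)) => //.
  + by move=> h; rewrite -(collapse_Sg n2) -iE /adj /=; have := collapse_le n2 h; lia.
  + by move=> h; rewrite -(collapse_Sg n2) -iE /adj /=; have := collapse_le n2 h; lia.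
Qed.

End Dynamics.

(** * The firing sequence from a full end is the periodic word *)

Section Inversion.
Variable n : nat.
Hypothesis n2 : 1 < n.
Implicit Types (g h : dgen n) (w : seq (dgen n)) (s : seq 'I_n.-1).

(** In the state [up j.+1] only the letters of level [j.+1] have charge 2, so
    there is no choice. *)
Lemma firing_up_inv s j w : map val s = iota j (size s) -> size s <= size w ->
  firing (up j.+1) w ->
  exists2 w', w = map Sg s ++ w' & firing (up (j + size s).+1) w'.
Proof.
elim: s j w => [|i s IH] j w; first by exists w; rewrite // addn0.
case: w => // g w /= [ij sj] sw; rewrite {1}/up eqSS => /andP[g2].
have {g2} -> : g = Sg i.
  apply/eqP; rewrite -(collapse_Sg n2) ij; move: g2.
  by case: (collapse g == j.+1); last by case: ifP.
have [_ /= ->] := @firing_up n n2 [:: i] j (congr1 (fun c => [:: c]) ij).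
by rewrite addn1 => /(IH _ _ sj sw)[w' -> f]; exists w'; rewrite // addnS -addSn.
Qed.

Lemma firing_down_inv s j w : map val s = rev (iota j (size s)) -> size s <= size w ->
  firing (down (j + size s)) w ->
  exists2 w', w = map Sg s ++ w' & firing (down j) w'.
Proof.
elim: s w => [|i s IH] w; first by exists w; rewrite -1?[j]addn0.
case: w => // g w; rewrite [size _]/= -[(size s).+1]addn1 iotaD rev_cat /= => -[ij sj] sw.
rewrite {1}/down addnA addn1 => /andP[g2].
have {g2} -> : g = Sg i.
  apply/eqP; rewrite -(collapse_Sg n2) ij; move: g2.
  by case: (collapse g == _.+1); last by case: ifP.
have [_ /=] := @firing_down n n2 [:: i] (j + size s) (congr1 (fun c => [:: c]) ij).
have {}sw : size s <= size w by rewrite addn1 in sw.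
by rewrite addn1 => -> /(IH _ sj sw)[w' -> f]; exists w'.
Qed.

Lemma firing_tpair_inv x y w : firing (down 0) [:: x, y & w] ->
  [:: x; y] = tpair n (x == T2) /\ firing (up 1) w.
Proof.
move=> f; suff E : [:: x; y] = tpair n (x == T2).
  split=> //; move: f; rewrite -[_ :: _]/([:: x; y] ++ w) E firing_cat.
  by have [_ ->] := firing_tpair n2 (x == T2) => /andP[].
move: f => /= /and3P[x2 y2 _]; move: x2 y2; rewrite /step /down.
have n0 : (n == 0) = false by lia.
have n1 : (n == 1) = false by lia.
case: x => [||i||] /=; rewrite ?n0 ?n1 //=; first 2 last.
- by case: (_ == 1).
all: move=> _; case: y => [||i||] //=; rewrite /adj /= ?n0 ?n1 //= ?orbF.
all: by case: (_ == 1).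
Qed.

Lemma firing_upair_inv x y w : firing (up n) [:: x, y & w] ->
  [:: x; y] = upair n (x == U2) /\ firing (down n.-1) w.
Proof.
move=> f; suff E : [:: x; y] = upair n (x == U2).
  split=> //; move: f; rewrite -[_ :: _]/([:: x; y] ++ w) E firing_cat.
  by have [_ ->] := firing_upair n2 (x == U2) => /andP[].
move: f => /= /and3P[x2 y2 _]; move: x2 y2; rewrite /step /up.
have n0 : (n == 0) = false by lia.
have n1 : (n == 1) = false by lia.
have Sgn (i : 'I_n.-1) : (i.+1 == n) = false by have := ltn_Sg n2 i; lia.
case: x => [||i||] /=; rewrite ?[_ == n]eq_sym ?n0 ?n1 //=.
  by rewrite [n == _]eq_sym Sgn; case: (n == _).
all: move=> _; case: y => [||i||] //=; rewrite /adj /= ?[_ == n]eq_sym ?n0 ?n1 //=.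
all: have := ltn_Sg n2 i => ni; rewrite [n == i.+1]eq_sym Sgn.
all: by rewrite (_ : (i.+1 == n.+1) = false) ?orbF; [case: (n == _)|lia].
Qed.

Lemma firing_period_inv w : firing (down 0) w -> size w = period_len n ->
  w = period n (nth T1 w 0 == T2) (nth T1 w n.+1 == U2).
Proof.
rewrite (period_lenE n2); case: w => [|x [|y w]]; try by move=> _ /=; lia.
move=> /(firing_tpair_inv)[xy f] [sw].
have szE : size (enum 'I_n.-1) = n.-1 by rewrite size_enum_ord.
have [||w1 wE f1] := firing_up_inv (s := enum 'I_n.-1) _ _ f.
- by rewrite val_enum_ord szE.
- by rewrite szE; lia.
move: sw f1; rewrite wE size_cat size_map szE add0n prednK; last by lia.
case: w1 wE => [|u [|v w1]] wE //= sw; try lia.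
move=> /firing_upair_inv[uv f2].
have f3 : firing (down (0 + size (rev (enum 'I_n.-1)))) w1 by rewrite size_rev szE.
have [||w2 w1E f4] := firing_down_inv _ _ f3.
- by rewrite map_rev val_enum_ord size_rev szE.
- by rewrite size_rev szE; lia.
have w20 : w2 = [::].
  by apply: size0nil; move: sw; rewrite w1E size_cat size_map size_rev szE; lia.
rewrite w1E w20 cats0 /period -/(tpair n _) -/(upair n _) -xy map_rev /=.
have nthS (T : Type) (d a : T) (t : seq T) m : 0 < m ->
    nth d (a :: t) m = nth d t m.-1.
  by case: m.
rewrite nthS; last by lia.
by rewrite nth_cat size_map szE ltnn subnn /= -uv.
Qed.

End Inversion.

Section Classification.
Variable n : nat.
Hypothesis n2 : 1 < n.

Lemma firing_periodic (f : nat -> dgen n) :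
  (forall d, firing (down 0) (mkseq f d)) ->
  exists a b, forall k, f k = periodic_word n a b k.
Proof.
move=> ff; set P := period_len n.
exists (fun q => f (q * P) == T2), (fun q => f (q * P + n.+1) == U2) => k.
have block q : final (down 0) (mkseq f (q * P)) = down 0 ->
    mkseq (fun i => f (q * P + i)) P =
    period n (f (q * P) == T2) (f (q * P + n.+1) == U2).
  move=> E; have := ff (q * P + P); rewrite mkseqD firing_cat E => /andP[_ fq].
  rewrite {1}(firing_period_inv n2 fq) ?size_mkseq // !nth_mkseq ?addn0 //.
    by rewrite /P (period_lenE n2); lia.
have start q : final (down 0) (mkseq f (q * P)) = down 0.
  elim: q => [//|q IH]; rewrite mulSnr mkseqD final_cat IH (block q IH).
  by have [_ ->] := firing_period n2 (f (q * P) == T2) (f (q * P + n.+1) == U2).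
have P0 : 0 < P by rewrite /P (period_lenE n2).
rewrite /periodic_word -/P -(block _ (start _)) nth_mkseq ?ltn_mod //.
by rewrite -divn_eq.
Qed.

Lemma cyc_fc_form (w : seq (dgen n)) : cyc_fc (affineD_matrix n) w -> cfc_form w.
Proof.
move=> cw; have [rep|nrep] := pselect (exists g, 1 < occ g w); last first.
  by apply: Or31 => g; rewrite leqNgt; apply/negP => g2; apply: nrep; exists g.
have bw := cyc_fc_balanced n2 cw rep; have w0 := size_w_gt0 rep.
have rf := charge_fires n2 cw rep; have rs := charge_step n2 cw rep.
have r2 := charge_le2 n2 cw rep; have rp := charge_period n2 cw rep.
have pp := unroll_period T1 w.
have pall g : exists2 i, i < size w & unroll T1 w i = g.
  have gw := all_in n2 cw rep g; exists (index g w); first by rewrite index_mem.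
  exact: (unroll_index n2 cw rep g).
have [o|e] := boolP (odd (charge w 0 T1 + charge w 0 T2)).
  apply: Or32; split=> //; rewrite -(unroll_mkseq T1 w).
  exact: (odd_alternating n2 w0 rf rs r2 rp pp pall o).
apply: Or33; split=> //.
have [k kd] := even_down0 n2 w0 rf rs r2 rp pp pall e.
have [d|a [b fE]] := @firing_periodic (fun i => unroll T1 w (k + i)).
  by rewrite -kd; have [] := firing_run rf rs k d.
(* The periodic word starts at time [k]; the copy of [w] that begins after
   [k] full turns lies beyond that time. *)
exists a, b, (k * size w - k); rewrite -[LHS](unroll_mkseq T1 w).
have kL : k <= k * size w by rewrite leq_pmulr.
apply: eq_map => j; rewrite -fE -(pp j k); congr unroll.
by rewrite addnA subnKC // addnC.
Qed.

Lemma form_cyc_fc (w : seq (dgen n)) : cfc_form w -> cyc_fc (affineD_matrix n) w.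
Proof.
move=> [w1|[aw bw]|[[a [b fw]] bw]] k.
- apply/fc_word_gapP => x s y z wE _; have := w1 s.
  have : perm_eq (rot k w) w by rewrite perm_rot.
  move/permP/(_ (pred1 s)); rewrite /occ wE => <-.
  by rewrite count_cat /= count_cat /= !eqxx; lia.
- exact: (alternating_fc n2 (alternating_rot n2 _ aw bw)).
- by have [r rw] := factor_firing n2 fw; apply: firing_cyc_fc rw bw _.
Qed.

End Classification.

Theorem theorem3p7 (n : nat) (hn : (2 <= n)%N) (x : affineD n) :
  (cyclically_fully_commutative x <->
     exists w : seq (dgen n), reduced_expr w x /\ cfc_form w) /\
  (cyclically_fully_commutative x <->
     forall w : seq (dgen n), reduced_expr w x -> cfc_form w).
Proof.
have [u ux] := ex_reduced_expr x.
have fwd : cyclically_fully_commutative x ->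
    forall w : seq (dgen n), reduced_expr w x -> cfc_form w.
  by move=> cx w wx; apply: cyc_fc_form => //; apply: cfc_cyc_fc cx wx; exact: affineD_m23.
have bwd (w : seq (dgen n)) : reduced_expr w x -> cfc_form w ->
    cyclically_fully_commutative x.
  move=> wx fw; have xE : x = cox_class _ w by rewrite -cox_prodE; case: wx.
  rewrite xE in wx *.
  by apply: cyc_fc_cfc; [exact: affineD_m23|apply: form_cyc_fc].
split; split.
- by move=> cx; exists u; split=> //; apply: fwd.
- by case=> w [wx fw]; apply: bwd wx fw.
- exact: fwd.
- by move=> fw; apply: bwd ux (fw u ux).
Qed.
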